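(* For each $\gamma_0>0$ let $\mathbf q_2^*(\gamma_0)=(q_{1,2}^*(\gamma_0),\dots,q_{N_f,2}^*(\gamma_0))$ be the optimal caching probability in the regime $\lambda_u/\lambda_2\to\infty$, i.e. the maximizer of $$P_{\rm off}^{\infty}(\mathbf q_2)=\sum_{f=1}^{N_f}\frac{p_f\,q_{f,2}}{\mathcal C_{1,\gamma_0}+\mathcal C_{2,\gamma_0}+(\mathcal C_{3,\gamma_0}+1)\,q_{f,2}}$$ subject to $\sum_{f=1}^{N_f}q_{f,2}\le N_c$ and $0\le q_{f,2}\le1$ for all $f$. Then, when $\gamma_0\to\infty$ with all other parameters fixed, the optimal caching probability is $q_{1,2}^*=\cdots=q_{N_c,2}^*=1$ and $q_{N_c+1,2}^*=\cdots=q_{N_f,2}^*=0$; that is, $\lim_{\gamma_0\to\infty}q_{f,2}^*(\gamma_0)=1$ for $1\le f\le N_c$ and $\lim_{\gamma_0\to\infty}q_{f,2}^*(\gamma_0)=0$ for $N_c<f\le N_f$.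
   Context: Parameters: $\lambda_{12}>0$ (ratio of macro-BS density to helper density), $P_{12}>0$ (ratio of transmit powers), $B_{12}>0$ (ratio of association bias factors), SINR threshold $\gamma_0>0$, $\alpha>2$, integer $M_1\ge1$, $M_2=1$, $M_{12}=M_1/M_2$. $N_f$ is the number of files, $N_c$ is the cache capacity, a positive integer with $N_c\le N_f$, and $p_f=f^{-\delta}/\sum_{n=1}^{N_f}n^{-\delta}$ with $\delta>0$. ${}_2F_1$ is the Gauss hypergeometric function (analytically continued to the negative real axis), $\Gamma$ the Gamma function, and $$\mathcal C_{1,\gamma_0}=\lambda_{12}(P_{12}B_{12})^{2/\alpha}\,{}_2F_1\Big[-\tfrac2\alpha,M_1;1-\tfrac2\alpha;-\tfrac{\gamma_0}{M_{12}B_{12}}\Big],\quad \mathcal C_{2,\gamma_0}=\frac{\Gamma(1-\frac2\alpha)\Gamma(M_2+\frac2\alpha)}{\Gamma(M_2)}\gamma_0^{2/\alpha},$$ $$\mathcal C_{3,\gamma_0}={}_2F_1\Big[-\tfrac2\alpha,M_2;1-\tfrac2\alpha;-\gamma_0\Big]-\mathcal C_{2,\gamma_0}-1.$$ *)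

(* Defs.v *)
From Stdlib Require Export Reals Factorial.
From Coquelicot Require Export Coquelicot.
Open Scope R_scope.

(* Euler's integral; only meaningful for x > 0. *)
Definition Gamma (x : R) : R :=
  RInt_gen (fun t => Rpower t (x - 1) * exp (- t)) (at_right 0) (Rbar_locally p_infty).

Fixpoint pochhammer (a : R) (n : nat) : R :=
  match n with
  | O => 1
  | S m => pochhammer a m * (a + INR m)
  end.

Definition hyp2F1_coef (a b c : R) (n : nat) : R :=
  pochhammer a n * pochhammer b n / (pochhammer c n * INR (fact n)).

Definition analytic_at (F : R -> R) (x0 : R) : Prop :=
  exists (u : nat -> R) (r : R), 0 < r /\
    forall x, Rabs (x - x0) < r -> is_pseries u (x - x0) (F x).

(* F is the restriction to (-oo, 1) of the principal branch (cut along
   [1, +oo)): by connectedness, such an F is unique on (-oo, 1). *)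
Definition is_hyp2F1_continuation (a b c : R) (F : R -> R) : Prop :=
  (forall x, Rabs x < 1 -> is_pseries (hyp2F1_coef a b c) x (F x)) /\
  (forall x, x < 1 -> analytic_at F x).

(* [iota] selects the unique value satisfying the predicate; only meaningful
   for z < 1 and c not a nonpositive integer. *)
Definition hyp2F1 (a b c z : R) : R :=
  iota (fun y : R => exists F, is_hyp2F1_continuation a b c F /\ F z = y).

Definition C1 (lambda12 P12 B12 alpha : R) (M1 M2 : nat) (gamma0 : R) : R :=
  let M12 := INR M1 / INR M2 in
  lambda12 * Rpower (P12 * B12) (2 / alpha) *
  hyp2F1 (- (2 / alpha)) (INR M1) (1 - 2 / alpha) (- (gamma0 / (M12 * B12))).

Definition C2 (alpha : R) (M2 : nat) (gamma0 : R) : R :=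
  Gamma (1 - 2 / alpha) * Gamma (INR M2 + 2 / alpha) / Gamma (INR M2) *
  Rpower gamma0 (2 / alpha).

Definition C3 (alpha : R) (M2 : nat) (gamma0 : R) : R :=
  hyp2F1 (- (2 / alpha)) (INR M2) (1 - 2 / alpha) (- gamma0)
  - C2 alpha M2 gamma0 - 1.

Definition zipf (delta : R) (Nf f : nat) : R :=
  Rpower (INR f) (- delta) /
  sum_n_m (fun n => Rpower (INR n) (- delta)) 1 Nf.

(* A caching vector is a function on nat of which only the entries with index
   in 1..Nf are relevant. *)
Definition P_off_inf (lambda12 P12 B12 alpha delta : R) (M1 M2 Nf : nat)
    (gamma0 : R) (q : nat -> R) : R :=
  sum_n_m (fun f =>
    zipf delta Nf f * q f /
    (C1 lambda12 P12 B12 alpha M1 M2 gamma0 + C2 alpha M2 gamma0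
     + (C3 alpha M2 gamma0 + 1) * q f)) 1 Nf.

Definition feasible (Nf Nc : nat) (q : nat -> R) : Prop :=
  sum_n_m q 1 Nf <= INR Nc /\
  forall f : nat, (1 <= f <= Nf)%nat -> 0 <= q f <= 1.

Definition is_optimal_caching (lambda12 P12 B12 alpha delta : R)
    (M1 M2 Nf Nc : nat) (gamma0 : R) (q : nat -> R) : Prop :=
  feasible Nf Nc q /\
  forall q' : nat -> R, feasible Nf Nc q' ->
    P_off_inf lambda12 P12 B12 alpha delta M1 M2 Nf gamma0 q' <=
    P_off_inf lambda12 P12 B12 alpha delta M1 M2 Nf gamma0 q.

(* Main.v *)
(* Write [s = 2/alpha] and [k = 1/(1-s)], and put [A = C1 + C2], [B = C3 + 1], so
   that the objective is a multiple of [sum_f p_f q_f / (1 + (B/A) q_f)]. Since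
   [C1 > 0], it suffices that [B/C2 -> 0]: the objective then tends uniformly to
   the linear form [sum_f p_f q_f], whose maximizer is unique because [p] is
   strictly decreasing.

   The function [2F1(-s, 1; 1-s; z)] is
   [1 - (k-1) z int_0^1 dv / (1 - z v^k)] for [z < 1], analytic by a geometric
   expansion under the integral sign; other integers [M1] follow by a contiguity
   recursion. By parts, the value at [- x] of this function is
   [1/(1+x) + x^s k int_0^(x^(1-s)) dv / (1+v^k)^2], and
   [k int_0^oo dv / (1+v^k)^2 = Gamma (1-s) Gamma (1+s)] by exchanging the order
   of integration in [y exp(- y (1+v^k))]. *)
Require Import Defs.
From Stdlib Require Import Reals.
From Coquelicot Require Import Coquelicot.
From Stdlib Require Import Lra Lia.
Open Scope R_scope.

(** * Real analytic functions and uniqueness of the continuation *)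

(** The arguments of 2F1 go to minus infinity, where the defining series diverges, and the value is
    fixed only through [iota]; hence an explicit continuation and an identity principle are both
    required. The variable [v] with [t = v^k] removes the singularity [t^(-s)] of Euler's integral
    at 0: since [k > 1], the integrands become continuous and proper integrals with a variable upper
    end suffice. The integration by parts serves the same purpose. Starting from [1 / (1 + v^k)] as
    the integral of [exp (- y (1 + v^k))], the exchange would produce [y^(s-1)], unbounded at 0; the
    square brings in a factor [y], and so the bounded integrand [y^s exp (- y)] of [Gamma (1 + s)].
    The exchange is carried out on bounded rectangles, by comparing derivatives in one side length;
    the limits then follow from one-sided bounds. The final convergence is quantitative: the gap
    between [p_Nc] and [p_(Nc+1)] controls the distance of a maximizer from the limit vector. *)

Lemma is_pseries_iff_lim (a : nat -> R) (x l : R) :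
  is_pseries a x l <-> is_lim_seq (sum_n (fun n => a n * x ^ n)) l.
Proof.
  unfold is_pseries, is_series, is_lim_seq.
  split; apply filterlim_ext; intros n; apply sum_n_ext; intros k;
    change (pow_n x k) with (@pow_n R_Ring x k); rewrite (pow_n_pow x k);
    unfold scal; simpl; unfold mult; simpl; ring.
Qed.

Lemma abs_is_RInt_le_const (f : R -> R) (a b l M : R) :
  a <= b -> is_RInt f a b l ->
  (forall t, a <= t <= b -> Rabs (f t) <= M) -> Rabs l <= (b - a) * M.
Proof.
  intros hab hl hM. rewrite <- (is_RInt_unique f a b l hl).
  apply abs_RInt_le_const; [exact hab | now exists l | exact hM].
Qed.

Lemma one_sub_mul_pos (x t : R) : x < 1 -> 0 <= t <= 1 -> 0 < 1 - x * t.
Proof. intros; destruct (Rle_dec x 0); nra. Qed.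

Lemma ex_RInt_comp_unit (p g : R -> R) :
  (forall v, 0 <= v <= 1 -> continuous p v) ->
  (forall v, 0 <= v <= 1 -> 0 <= p v <= 1) ->
  (forall t, 0 <= t <= 1 -> ex_derive g t) ->
  ex_RInt (fun v => g (p v)) 0 1.
Proof.
  intros hp hp01 hg.
  apply (ex_RInt_continuous (V := R_CompleteNormedModule)).
  rewrite Rmin_left, Rmax_right by lra.
  intros z hz.
  apply (continuous_comp p g); [now apply hp |].
  apply (ex_derive_continuous g), hg, hp01, hz.
Qed.

(** * Power series expansion of a resolvent integral about any point below 1 *)

Section Resolvent.

Variable p : R -> R.
Hypothesis p_cont : forall v, 0 <= v <= 1 -> continuous p v.
Hypothesis p_unit : forall v, 0 <= v <= 1 -> 0 <= p v <= 1.

(** Used for [p v = v^k], the integral inside the hypergeometric function, and for [p = 1], where it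
    equals [1 / (1 - x)]. *)
Definition resolvent_int (x : R) : R := RInt (fun v => / (1 - x * p v)) 0 1.

(** Taylor coefficient of [resolvent_int] at [x0], read off from
    [1 - x p = (1 - x0 p) - (x - x0) p]. *)
Definition resolvent_coef (x0 : R) (n : nat) : R :=
  RInt (fun v => p v ^ n / (1 - x0 * p v) ^ S n) 0 1.

Lemma is_RInt_resolvent_coef (x0 : R) (n : nat) : x0 < 1 ->
  is_RInt (fun v => p v ^ n / (1 - x0 * p v) ^ S n) 0 1 (resolvent_coef x0 n).
Proof.
  intros hx0.
  apply (RInt_correct (V := R_CompleteNormedModule)).
  apply (ex_RInt_comp_unit p (fun t => t ^ n / (1 - x0 * t) ^ S n)); auto.
  intros t ht. pose proof (one_sub_mul_pos x0 t hx0 ht).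
  auto_derive. change ((1 - x0 * t) ^ S n <> 0).
  apply pow_nonzero; lra.
Qed.

Lemma is_RInt_resolvent (x : R) : x < 1 ->
  is_RInt (fun v => / (1 - x * p v)) 0 1 (resolvent_int x).
Proof.
  intros hx.
  apply (RInt_correct (V := R_CompleteNormedModule)).
  apply (ex_RInt_comp_unit p (fun t => / (1 - x * t))); auto.
  intros t ht. pose proof (one_sub_mul_pos x t hx ht).
  auto_derive. lra.
Qed.

(** A finite geometric sum of ratio [(x - x0) p / (1 - x0 p)]. Its exact remainder stays inside the
    integrand, so no series is ever integrated term by term. *)
Lemma is_RInt_resolvent_partial_sum (x0 x : R) (N : nat) : x0 < 1 -> x < 1 ->
  is_RInt (fun v => / (1 - x * p v)
             - ((x - x0) * p v / (1 - x0 * p v)) ^ S N / (1 - x * p v)) 0 1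
    (sum_n (fun n => resolvent_coef x0 n * (x - x0) ^ n) N).
Proof.
  intros hx0 hx.
  induction N as [|N IH].
  - rewrite sum_O.
    generalize (is_RInt_resolvent_coef x0 0 hx0); intros h.
    apply (is_RInt_ext (fun v => p v ^ 0 / (1 - x0 * p v) ^ 1)).
    + rewrite Rmin_left, Rmax_right by lra. intros v hv.
      assert (hv' : 0 <= v <= 1) by lra.
      pose proof (one_sub_mul_pos x0 (p v) hx0 (p_unit v hv')).
      pose proof (one_sub_mul_pos x (p v) hx (p_unit v hv')).
      simpl. field. lra.
    + replace (resolvent_coef x0 0 * (x - x0) ^ 0) with (resolvent_coef x0 0)
        by (simpl; ring).
      exact h.
  - rewrite sum_Sn.
    generalize (is_RInt_plus _ _ _ _ _ _ IH
      (is_RInt_scal _ _ _ ((x - x0) ^ S N) _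
         (is_RInt_resolvent_coef x0 (S N) hx0))); intros h.
    replace (resolvent_coef x0 (S N) * (x - x0) ^ S N)
      with (scal ((x - x0) ^ S N) (resolvent_coef x0 (S N)))
      by (unfold scal; simpl; unfold mult; simpl; ring).
    refine (is_RInt_ext _ _ _ _ _ _ h).
    rewrite Rmin_left, Rmax_right by lra. intros v hv.
    assert (hv' : 0 <= v <= 1) by lra.
    pose proof (one_sub_mul_pos x0 (p v) hx0 (p_unit v hv')).
    pose proof (one_sub_mul_pos x (p v) hx (p_unit v hv')).
    unfold plus, scal; simpl; unfold mult; simpl.
    assert (hD : (1 - x0 * p v) ^ N <> 0) by (apply pow_nonzero; lra).
    unfold Rdiv. rewrite !Rpow_mult_distr, !pow_inv.
    field. repeat split; lra.
Qed.

(** The function [t / (1 - x0 t)] increases on [0, 1], so the geometric ratio is at most its value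
    [r] at [t = 1], uniformly in [v]. The radius [1 - x0] is the distance to the singularity at
    1. *)
Lemma is_pseries_resolvent (x0 x : R) : x0 < 1 -> Rabs (x - x0) < 1 - x0 ->
  is_pseries (resolvent_coef x0) (x - x0) (resolvent_int x).
Proof.
  intros hx0 hxx.
  assert (hx : x < 1) by (apply Rabs_def2 in hxx; lra).
  apply is_pseries_iff_lim.
  (* [1 - x t] is affine in [t], so its minimum over [0, 1] is attained at an endpoint. *)
  set (m := Rmin 1 (1 - x)).
  assert (hm : 0 < m) by (apply Rmin_glb_lt; lra).
  set (r := Rabs (x - x0) / (1 - x0)).
  assert (hr : 0 <= r < 1).
  { unfold r. pose proof (Rabs_pos (x - x0)). split.
    - apply Rdiv_le_0_compat; lra.
    - apply Rlt_div_l; lra. }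
  assert (hbound : forall N,
    Rabs (sum_n (fun n => resolvent_coef x0 n * (x - x0) ^ n) N
          - resolvent_int x) <= r ^ S N * / m).
  { intros N.
    generalize (is_RInt_minus _ _ _ _ _ _
      (is_RInt_resolvent_partial_sum x0 x N hx0 hx) (is_RInt_resolvent x hx)).
    intros h.
    replace (r ^ S N * / m) with ((1 - 0) * (r ^ S N * / m)) by ring.
    refine (abs_is_RInt_le_const _ _ _ _ _ Rle_0_1 h _).
    intros v hv.
    pose proof (p_unit v hv) as ht.
    pose proof (one_sub_mul_pos x0 (p v) hx0 ht).
    pose proof (one_sub_mul_pos x (p v) hx ht).
    unfold minus, plus, opp; cbn -[pow].
    match goal with |- Rabs ?e <= _ =>
      replace e with
        (- (((x - x0) * p v / (1 - x0 * p v)) ^ S N * / (1 - x * p v)))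
        by (field; lra) end.
    rewrite Rabs_Ropp, Rabs_mult, <- RPow_abs.
    apply Rmult_le_compat.
    - apply pow_le, Rabs_pos.
    - apply Rabs_pos.
    - apply pow_incr. split; [apply Rabs_pos |].
      unfold Rdiv. rewrite !Rabs_mult, Rabs_inv.
      rewrite (Rabs_pos_eq (p v)), (Rabs_pos_eq (1 - x0 * p v)) by lra.
      unfold r. unfold Rdiv. rewrite Rmult_assoc.
      apply Rmult_le_compat_l; [apply Rabs_pos |].
      apply (Rmult_le_reg_r ((1 - x0) * (1 - x0 * p v))); [nra |].
      field_simplify; [|lra|lra]. nra.
    - rewrite Rabs_pos_eq by (left; apply Rinv_0_lt_compat; lra).
      apply Rinv_le_contravar; [exact hm |].
      unfold m. destruct (Rle_dec x 0).
      + eapply Rle_trans; [apply Rmin_l | nra].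
      + eapply Rle_trans; [apply Rmin_r | nra]. }
  apply is_lim_seq_spec. intros eps.
  assert (hg : is_lim_seq (fun n => r ^ S n * / m) 0).
  { apply (is_lim_seq_incr_1 (fun n => r ^ n * / m)).
    replace (Finite 0) with (Rbar_mult 0 (/ m)) by (simpl; f_equal; ring).
    apply is_lim_seq_scal_r, is_lim_seq_geom.
    rewrite Rabs_pos_eq; lra. }
  apply is_lim_seq_spec in hg.
  destruct (hg eps) as [N hN]. exists N. intros n hn.
  eapply Rle_lt_trans; [apply hbound |].
  specialize (hN n hn).
  apply Rabs_def2 in hN. lra.
Qed.

End Resolvent.

(** The strict inequality comes from convergence at a point [y] strictly between [Rabs x] and [r]:
    outside the disc of convergence the terms would not tend to 0. *)
Lemma CV_radius_ge_of_is_pseries (u : nat -> R) (F : R -> R) (r x : R) :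
  (forall y, Rabs y < r -> is_pseries u y (F y)) ->
  Rabs x < r -> Rbar_lt (Rabs x) (CV_radius u).
Proof.
  intros h hx.
  set (y := (Rabs x + r) / 2).
  assert (hy : Rabs x < y < r) by (unfold y; lra).
  assert (hy0 : 0 < y) by (pose proof (Rabs_pos x); lra).
  apply Rbar_lt_le_trans with (Finite y); [exact (proj1 hy) |].
  destruct (Rbar_le_lt_dec y (CV_radius u)) as [|hlt]; auto.
  exfalso.
  assert (hlt' : Rbar_lt (CV_radius u) (Rabs y)) by (rewrite Rabs_pos_eq; [exact hlt | lra]).
  apply (CV_disk_outside _ _ hlt').
  assert (hs : is_pseries u y (F y)) by (apply h; rewrite Rabs_pos_eq; lra).
  apply (ex_series_lim_0 (fun n => u n * y ^ n)).
  exists (F y).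
  revert hs. apply is_series_ext. intros n.
  rewrite pow_n_pow; unfold scal; simpl; unfold mult; simpl; ring.
Qed.

(** * Closure properties of analytic functions *)

Lemma analytic_at_ext (F G : R -> R) (x0 : R) :
  (forall x, F x = G x) -> analytic_at F x0 -> analytic_at G x0.
Proof.
  intros he (u & r & hr & h). exists u, r. split; [exact hr |].
  intros x hx. rewrite <- he. auto.
Qed.

Lemma is_pseries_const (c x : R) :
  is_pseries (fun n => match n with O => c | _ => 0 end) x c.
Proof.
  apply is_pseries_iff_lim.
  apply is_lim_seq_ext with (fun _ => c); [|apply is_lim_seq_const].
  intros n. induction n as [|n IH].
  - rewrite sum_O. simpl. ring.
  - rewrite sum_Sn, <- IH. unfold plus; simpl. ring.
Qed.

Lemma analytic_at_const (c x0 : R) : analytic_at (fun _ => c) x0.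
Proof.
  exists (fun n => match n with O => c | _ => 0 end), 1. split; [lra |].
  intros x _. apply is_pseries_const.
Qed.

Lemma analytic_at_plus (F G : R -> R) (x0 : R) :
  analytic_at F x0 -> analytic_at G x0 -> analytic_at (fun x => F x + G x) x0.
Proof.
  intros (u & r & hr & hu) (v & q & hq & hv).
  exists (PS_plus u v), (Rmin r q). split; [now apply Rmin_glb_lt |].
  intros x hx. apply (is_pseries_plus (K := R_AbsRing) (V := R_NormedModule)).
  - apply hu. eapply Rlt_le_trans; [exact hx | apply Rmin_l].
  - apply hv. eapply Rlt_le_trans; [exact hx | apply Rmin_r].
Qed.

Lemma analytic_at_mult (F G : R -> R) (x0 : R) :
  analytic_at F x0 -> analytic_at G x0 -> analytic_at (fun x => F x * G x) x0.
Proof.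
  intros (u & r & hr & hu) (v & q & hq & hv).
  exists (PS_mult u v), (Rmin r q). split; [now apply Rmin_glb_lt |].
  intros x hx.
  assert (hxr : Rabs (x - x0) < r) by (eapply Rlt_le_trans; [exact hx | apply Rmin_l]).
  assert (hxq : Rabs (x - x0) < q) by (eapply Rlt_le_trans; [exact hx | apply Rmin_r]).
  apply is_pseries_mult; auto.
  - apply (CV_radius_ge_of_is_pseries u (fun y => F (x0 + y)) r); auto.
    intros y hy. replace y with (x0 + y - x0) at 1 by ring.
    apply hu. now replace (x0 + y - x0) with y by ring.
  - apply (CV_radius_ge_of_is_pseries v (fun y => G (x0 + y)) q); auto.
    intros y hy. replace y with (x0 + y - x0) at 1 by ring.
    apply hv. now replace (x0 + y - x0) with y by ring.
Qed.

Lemma analytic_at_id (x0 : R) : analytic_at (fun x => x) x0.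
Proof.
  exists (PS_plus (fun n => match n with O => x0 | _ => 0 end)
            (PS_incr_1 (fun n => match n with O => 1 | _ => 0 end))), 1.
  split; [lra |].
  intros x hx.
  refine (eq_ind _ (is_pseries _ (x - x0))
    (is_pseries_plus _ _ _ _ _ (is_pseries_const x0 (x - x0))
      (is_pseries_incr_1 _ _ _ (is_pseries_const 1 (x - x0)))) x _).
  unfold plus, scal; simpl; unfold mult; simpl; ring.
Qed.

Lemma analytic_at_resolvent (p : R -> R) (x0 : R) :
  (forall v, 0 <= v <= 1 -> continuous p v) ->
  (forall v, 0 <= v <= 1 -> 0 <= p v <= 1) ->
  x0 < 1 -> analytic_at (resolvent_int p) x0.
Proof.
  intros hc hp hx0. exists (resolvent_coef p x0), (1 - x0). split; [lra |].
  intros x hx. now apply is_pseries_resolvent.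
Qed.

(** Zeros are assumed on one side only, which is what a supremum argument provides. Continuity at 0
    gives [u 0 = 0]; dividing by [x] shifts the coefficients, and the induction continues. *)
Lemma pseries_zero_right (F : R -> R) (u : nat -> R) (r : R) : 0 < r ->
  (forall x, Rabs x < r -> is_pseries u x (F x)) ->
  (forall x, 0 < x < r -> F x = 0) -> forall n, u n = 0.
Proof.
  intros hr hu hF n. revert u F hu hF.
  assert (h0 : forall u F, (forall x, Rabs x < r -> is_pseries u x (F x)) ->
    (forall x, 0 < x < r -> F x = 0) -> u O = 0).
  { intros u F hu hF.
    assert (hcont : continuity_pt (PSeries u) 0).
    { apply PSeries_continuity.
      apply (CV_radius_ge_of_is_pseries u F r); auto. rewrite Rabs_R0; lra. }
    rewrite <- PSeries_0.
    destruct (Req_dec (PSeries u 0) 0) as [|hne]; [assumption | exfalso].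
    (* The tolerance is the supposed nonzero value itself: at a zero [x] of the sum the deviation
       from it is exactly that large, hence not smaller. *)
    destruct (hcont (Rabs (PSeries u 0))) as (d & hd & hcd); [now apply Rabs_pos_lt |].
    set (x := Rmin d r / 2).
    assert (hx : 0 < x < r /\ x < d).
    { unfold x. assert (0 < Rmin d r) by (now apply Rmin_glb_lt).
      pose proof (Rmin_l d r). pose proof (Rmin_r d r). lra. }
    specialize (hcd x). simpl in hcd. unfold R_dist in hcd.
    rewrite (is_pseries_unique u x (F x)) in hcd
      by (apply hu; rewrite Rabs_pos_eq; lra).
    rewrite hF, Rminus_0_l, Rabs_Ropp in hcd by lra.
    apply (Rlt_irrefl (Rabs (PSeries u 0))), hcd.
    unfold D_x, no_cond. rewrite Rminus_0_r, Rabs_pos_eq by lra.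
    repeat split; lra. }
  induction n as [|n IH]; intros u F hu hF; [now apply (h0 u F) |].
  assert (hu0 := h0 u F hu hF).
  apply (IH (PS_decr_1 u) (fun x => PSeries (PS_decr_1 u) x)).
  - intros x hx. apply (PSeries_correct (PS_decr_1 u) x).
    apply CV_radius_inside. rewrite CV_radius_decr_1.
    now apply (CV_radius_ge_of_is_pseries u F r).
  - intros x hx.
    assert (hs : is_pseries u x (F x)) by (apply hu; rewrite Rabs_pos_eq; lra).
    pose proof (PSeries_decr_1 u x (ex_intro _ _ hs)) as he.
    rewrite (is_pseries_unique _ _ _ hs), hF, hu0 in he by lra. nra.
Qed.

(** All coefficients at [m] vanish, so zeros on the right of [m] spread across [m] to the left. *)
Lemma analytic_at_left_zero (F : R -> R) (m e : R) : 0 < e ->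
  analytic_at F m -> (forall x, m < x < m + e -> F x = 0) ->
  exists r, 0 < r /\ forall x, Rabs (x - m) < r -> F x = 0.
Proof.
  intros he (u & r & hr & hu) hF.
  exists (Rmin r e). split; [now apply Rmin_glb_lt |].
  intros x hx.
  assert (hz : forall n, u n = 0).
  { apply (pseries_zero_right (fun y => F (m + y)) u (Rmin r e)).
    - now apply Rmin_glb_lt.
    - intros y hy. replace y with (m + y - m) at 1 by ring. apply hu.
      replace (m + y - m) with y by ring.
      eapply Rlt_le_trans; [exact hy | apply Rmin_l].
    - intros y hy. apply hF. pose proof (Rmin_r r e). lra. }
  assert (hs : is_pseries u (x - m) (F x))
    by (apply hu; eapply Rlt_le_trans; [exact hx | apply Rmin_l]).
  rewrite <- (is_pseries_unique _ _ _ hs).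
  rewrite (PSeries_ext u (fun _ => 0)) by exact hz.
  apply PSeries_const_0.
Qed.

(** Identity principle by connectedness: if [m] is the supremum of the points where [F] is nonzero,
    then [F] vanishes just to the right of [m], hence all around [m], which contradicts the
    supremum. *)
Lemma analytic_zero_left (F : R -> R) (b : R) :
  (forall x, x <= b -> analytic_at F x) ->
  (exists e, 0 < e /\ forall x, b - e < x <= b -> F x = 0) ->
  forall x, x <= b -> F x = 0.
Proof.
  intros ha (e & he & hb) z hz.
  destruct (Req_dec (F z) 0) as [|hne]; [assumption | exfalso].
  set (E := fun x => x <= b /\ F x <> 0).
  destruct (completeness E) as (m & hub & hlub).
  { exists b. intros x (hx & _). exact hx. }
  { exists z. now split. }
  assert (hmz : z <= m) by (apply hub; now split).
  (* This keeps the interval from [m] to [m + e] below [b], where [F] is known to be analytic. *)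
  assert (hmb : m <= b - e).
  { apply hlub. intros x (hx & hFx).
    destruct (Rle_dec x (b - e)); [assumption |].
    exfalso. apply hFx, hb. lra. }
  destruct (analytic_at_left_zero F m e he) as (r & hr & hFr).
  { apply ha. lra. }
  { intros x hx. destruct (Req_dec (F x) 0) as [|hx0]; [assumption |].
    exfalso. assert (x <= m) by (apply hub; split; [lra | assumption]). lra. }
  assert (m <= m - r); [|lra].
  apply hlub. intros x (hx & hFx).
  destruct (Rle_dec x (m - r)); [assumption |].
  exfalso. apply hFx, hFr.
  assert (x <= m) by (apply hub; now split).
  apply Rabs_def1; lra.
Qed.

Lemma is_hyp2F1_continuation_unique (a b c : R) (F G : R -> R) :
  is_hyp2F1_continuation a b c F -> is_hyp2F1_continuation a b c G ->
  forall x, x < 1 -> F x = G x.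
Proof.
  intros (hF & hFa) (hG & hGa) x hx.
  assert (hin : forall y, Rabs y < 1 -> F y = G y).
  { intros y hy.
    rewrite <- (is_pseries_unique _ _ _ (hF y hy)).
    apply is_pseries_unique, hG, hy. }
  destruct (Rle_dec x 0) as [h0|h0].
  - enough (F x + (-1) * G x = 0) by lra.
    apply (analytic_zero_left (fun y => F y + (-1) * G y) 0); [| |exact h0].
    + intros y hy. apply analytic_at_plus; [apply hFa; lra |].
      apply analytic_at_mult; [apply analytic_at_const | apply hGa; lra].
    + exists 1. split; [lra |]. intros y hy.
      rewrite (hin y); [ring |]. apply Rabs_def1; lra.
  - apply hin. apply Rabs_def1; lra.
Qed.

(** By uniqueness, any one explicit continuation determines the value chosen by [iota]. *)
Lemma hyp2F1_eq (a b c : R) (F : R -> R) (z : R) :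
  is_hyp2F1_continuation a b c F -> z < 1 -> hyp2F1 a b c z = F z.
Proof.
  intros hF hz. unfold hyp2F1.
  apply (iota_unique (K := R_AbsRing) (V := R_CompleteNormedModule)).
  - intros y (G & hG & <-). now apply (is_hyp2F1_continuation_unique a b c).
  - now exists F.
Qed.

(** * The continuation of 2F1(-s, M; 1-s; z) *)

Lemma Rpower_ge_0 (x k : R) : 0 <= Rpower x k.
Proof. left; apply exp_pos. Qed.

(* [Rpower 0 k] is [1]; [rpow 0 k] is [0], so that [rpow _ k] is continuous. *)
Definition rpow (x k : R) : R := if Rle_dec x 0 then 0 else Rpower x k.

Lemma rpow_pos_eq (x k : R) : 0 < x -> rpow x k = Rpower x k.
Proof. intros hx. unfold rpow. destruct (Rle_dec x 0); [lra | reflexivity]. Qed.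

Lemma rpow_nonpos (x k : R) : x <= 0 -> rpow x k = 0.
Proof. intros hx. unfold rpow. destruct (Rle_dec x 0); [reflexivity | lra]. Qed.

Lemma rpow_ge_0 (x k : R) : 0 <= rpow x k.
Proof.
  unfold rpow. destruct (Rle_dec x 0); [lra | apply Rpower_ge_0].
Qed.

Lemma Rpower_1_l (k : R) : Rpower 1 k = 1.
Proof. unfold Rpower. rewrite ln_1, Rmult_0_r. apply exp_0. Qed.

Lemma rpow_le (x y k : R) : 0 <= k -> x <= y -> rpow x k <= rpow y k.
Proof.
  intros hk hxy. destruct (Rle_dec x 0) as [hx|hx].
  - rewrite (rpow_nonpos x) by exact hx. apply rpow_ge_0.
  - rewrite !rpow_pos_eq by lra. apply Rle_Rpower_l; lra.
Qed.

Lemma rpow_unit (x k : R) : 0 <= k -> x <= 1 -> 0 <= rpow x k <= 1.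
Proof.
  intros hk hx. split; [apply rpow_ge_0 |].
  replace 1 with (rpow 1 k) by (rewrite rpow_pos_eq by lra; apply Rpower_1_l).
  now apply rpow_le.
Qed.

Lemma is_derive_Rpower (x k : R) : 0 < x ->
  is_derive (fun y => Rpower y k) x (k * Rpower x (k - 1)).
Proof.
  intros hx. apply is_derive_Reals. now apply derivable_pt_lim_power.
Qed.

Lemma continuous_Rpower (x k : R) : 0 < x -> continuous (fun y => Rpower y k) x.
Proof.
  intros hx. apply (ex_derive_continuous (fun y => Rpower y k)).
  eexists. now apply is_derive_Rpower.
Qed.

Lemma locally_pos (x : R) : 0 < x -> locally x (fun y => 0 < y).
Proof. apply (open_gt 0). Qed.

Lemma is_derive_rpow (x k : R) : 0 < x ->
  is_derive (fun y => rpow y k) x (k * Rpower x (k - 1)).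
Proof.
  intros hx. apply (is_derive_ext_loc (fun y => Rpower y k)).
  - apply (filter_imp (fun y => 0 < y)); [|now apply locally_pos].
    intros y hy. now rewrite rpow_pos_eq.
  - now apply is_derive_Rpower.
Qed.

(** Supplies the radius [e^(1/k)] for continuity of a power at 0, and for its differentiability
    there with [k - 1] in place of [k]. *)
Lemma Rpower_lt_of_lt_root (x e k : R) : 0 < k -> 0 < e -> 0 < x ->
  x < Rpower e (/ k) -> Rpower x k < e.
Proof.
  intros hk he hx h.
  replace e with (Rpower (Rpower e (/ k)) k)
    by (rewrite Rpower_mult, Rinv_l by lra; now apply Rpower_1).
  apply Rlt_Rpower_l; lra.
Qed.

Lemma continuous_rpow (x k : R) : 0 < k -> continuous (fun y => rpow y k) x.
Proof.
  intros hk. destruct (Rlt_dec 0 x) as [hx|hx].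
  - apply (ex_derive_continuous (fun y => rpow y k)).
    eexists. now apply is_derive_rpow.
  - unfold continuous. rewrite rpow_nonpos by lra.
    apply (filterlim_locally (fun y => rpow y k) 0). intros e.
    exists (mkposreal (Rpower e (/ k)) (exp_pos _)).
    intros y hy. apply Rabs_def2 in hy. unfold minus, plus, opp in hy; simpl in hy.
    change (Rabs (rpow y k - 0) < e).
    rewrite Rminus_0_r, Rabs_pos_eq by apply rpow_ge_0.
    destruct (Rle_dec y 0) as [hy0|hy0].
    + rewrite rpow_nonpos by exact hy0. apply cond_pos.
    + rewrite rpow_pos_eq by lra.
      apply Rpower_lt_of_lt_root; [exact hk | apply cond_pos | lra | lra].
Qed.

Lemma rpow_mult_l (a x k : R) : 0 < a -> rpow (a * x) k = Rpower a k * rpow x k.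
Proof.
  intros ha. destruct (Rle_dec x 0) as [hx|hx].
  - rewrite !rpow_nonpos by nra. ring.
  - rewrite !rpow_pos_eq by nra. symmetry. apply Rpower_mult_distr; lra.
Qed.

(** The exponent [n = 0] is excluded: for [x <= 0] the left side would be 1 and the right side 0. *)
Lemma rpow_pow (x k : R) (n : nat) : (0 < n)%nat ->
  rpow x k ^ n = rpow x (k * INR n).
Proof.
  intros hn. destruct (Rle_dec x 0) as [hx|hx].
  - rewrite !rpow_nonpos by exact hx. now apply pow_i.
  - rewrite !rpow_pos_eq by lra. rewrite <- Rpower_mult.
    symmetry. apply Rpower_pow, exp_pos.
Qed.

(** At 0 the difference quotient is [h^(k-1)] on the right and 0 on the left. Covering this endpoint
    lets primitives be used on intervals starting at 0. *)
Lemma is_derive_rpow_gt_1 (x k : R) : 1 < k ->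
  is_derive (fun y => rpow y k) x (k * rpow x (k - 1)).
Proof.
  intros hk. destruct (Rlt_dec 0 x) as [hx|hx].
  { rewrite (rpow_pos_eq x (k - 1)) by exact hx. now apply is_derive_rpow. }
  rewrite (rpow_nonpos x (k - 1)), Rmult_0_r by lra.
  destruct (Rlt_dec x 0) as [hx0|hx0].
  { apply (is_derive_ext_loc (fun _ => 0)).
    - apply (filter_imp (fun y => y < 0)); [|now apply (open_lt 0)].
      intros y hy. rewrite rpow_nonpos by lra. reflexivity.
    - apply (is_derive_const (V := R_NormedModule) 0). }
  replace x with 0 by lra.
  apply is_derive_Reals. intros e he.
  exists (mkposreal (Rpower e (/ (k - 1))) (exp_pos _)).
  intros h hh0 hh. simpl in hh. apply Rabs_def2 in hh.
  rewrite Rplus_0_l, (rpow_nonpos 0), !Rminus_0_r by lra.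
  destruct (Rle_dec h 0) as [hh1|hh1].
  - rewrite rpow_nonpos by exact hh1. unfold Rdiv. rewrite Rmult_0_l, Rabs_R0.
    exact he.
  - rewrite rpow_pos_eq by lra.
    replace (Rpower h k / h) with (Rpower h (k - 1)).
    + rewrite Rabs_pos_eq by apply Rpower_ge_0.
      apply Rpower_lt_of_lt_root; lra.
    + replace k with (k - 1 + 1) at 2 by ring.
      rewrite Rpower_plus, Rpower_1 by lra. field. lra.
Qed.

Lemma is_RInt_rpow (k : R) : 0 < k ->
  is_RInt (fun v => rpow v k) 0 1 (/ (k + 1)).
Proof.
  intros hk.
  assert (h : is_RInt (fun v => rpow v k) 0 1
    (minus (/ (k + 1) * rpow 1 (k + 1)) (/ (k + 1) * rpow 0 (k + 1)))).
  { apply (is_RInt_derive (fun v => / (k + 1) * rpow v (k + 1))).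
    - intros x _.
      replace (rpow x k) with (/ (k + 1) * ((k + 1) * rpow x (k + 1 - 1)))
        by (replace (k + 1 - 1) with k by ring; field; lra).
      apply (is_derive_scal (fun v => rpow v (k + 1))).
      apply is_derive_rpow_gt_1. lra.
    - intros x _. now apply continuous_rpow. }
  rewrite rpow_pos_eq, Rpower_1_l, rpow_nonpos in h by lra.
  unfold minus, plus, opp in h; simpl in h.
  now replace (/ (k + 1)) with (/ (k + 1) * 1 + - (/ (k + 1) * 0)) by ring.
Qed.

Section Continuation.

Variable s : R.
Hypothesis s_range : 0 < s < 1.

(* After the substitution [t = v^k] with [k = 1/(1-s)], this is Euler's
   integral [1 - s z * int_0^1 t^(-s) / (1 - z t) dt]. *)
Definition hypF1 (z : R) : R :=
  1 - (/ (1 - s) - 1) * z * resolvent_int (fun v => rpow v (/ (1 - s))) z.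

(* [hypF m] has numerator parameter [m + 1]. The recursion combines the
   contiguity relation [F_(M+1) = F_M + (z/M) F_M'] with
   [z F_M' = s F_M - s (1-z)^(-M)]. *)
Fixpoint hypF (m : nat) (z : R) : R :=
  match m with
  | O => hypF1 z
  | S m' => (1 + s / INR (S m')) * hypF m' z - s / INR (S m') * / (1 - z) ^ S m'
  end.

Lemma inv_one_sub_gt_1 : 1 < / (1 - s).
Proof.
  rewrite <- Rinv_1 at 1. apply Rinv_lt_contravar; lra.
Qed.

Lemma rpow_inv_continuous v : 0 <= v <= 1 ->
  continuous (fun v => rpow v (/ (1 - s))) v.
Proof. intros _. apply continuous_rpow. pose proof inv_one_sub_gt_1; lra. Qed.

Lemma rpow_inv_unit v : 0 <= v <= 1 -> 0 <= rpow v (/ (1 - s)) <= 1.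
Proof. intros hv. apply rpow_unit; [pose proof inv_one_sub_gt_1 |]; lra. Qed.

(** The two products run over ranges shifted by one, so only their end factors differ. This is why
    the coefficients with [c = a + 1] reduce to [- s / (n - s)] times those of a binomial series. *)
Lemma pochhammer_ratio (n : nat) :
  pochhammer (- s) n * (INR n - s) = - s * pochhammer (1 - s) n.
Proof.
  induction n as [|n IH].
  - simpl. ring.
  - cbn [pochhammer]. rewrite S_INR.
    replace (pochhammer (- s) n * (- s + INR n) * (INR n + 1 - s))
      with (pochhammer (- s) n * (INR n - s) * (INR n + 1 - s)) by ring.
    rewrite IH. ring.
Qed.

Lemma INR_sub_neq_0 (n : nat) : INR n - s <> 0.
Proof.
  destruct n as [|n].
  - simpl. lra.
  - rewrite S_INR. pose proof (pos_INR n). lra.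
Qed.

Lemma pochhammer_pos (a : R) (n : nat) : 0 < a -> 0 < pochhammer a n.
Proof.
  intros ha. induction n as [|n IH]; simpl; [lra |].
  pose proof (pos_INR n). apply Rmult_lt_0_compat; lra.
Qed.

Lemma hyp2F1_coef_eq (b : R) (n : nat) :
  hyp2F1_coef (- s) b (1 - s) n = - s / (INR n - s) * (pochhammer b n / INR (fact n)).
Proof.
  unfold hyp2F1_coef.
  pose proof (pochhammer_pos (1 - s) n). pose proof (INR_fact_neq_0 n).
  pose proof (INR_sub_neq_0 n).
  replace (pochhammer (- s) n) with (- s * pochhammer (1 - s) n / (INR n - s))
    by (rewrite <- pochhammer_ratio; field; assumption).
  field. repeat split; auto. lra.
Qed.

Lemma pochhammer_1 (n : nat) : pochhammer 1 n = INR (fact n).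
Proof.
  induction n as [|n IH]; [reflexivity |].
  cbn [pochhammer]. rewrite IH, fact_simpl, mult_INR, S_INR. ring.
Qed.

Lemma pochhammer_succ (b : R) (n : nat) :
  b * pochhammer (b + 1) n = pochhammer b n * (b + INR n).
Proof.
  induction n as [|n IH]; [simpl; ring |].
  cbn [pochhammer]. rewrite <- Rmult_assoc, IH, S_INR. ring.
Qed.

Lemma resolvent_coef_rpow_0 (n : nat) :
  resolvent_coef (fun v => rpow v (/ (1 - s))) 0 n = (1 - s) / (INR (S n) - s).
Proof.
  unfold resolvent_coef. apply is_RInt_unique.
  pose proof inv_one_sub_gt_1.
  (* For [n = 0] the integrand is the constant 1, which [rpow v 0] is not at [v = 0]. *)
  destruct n as [|n].
  - apply (is_RInt_ext (fun _ => 1)).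
    { intros v _. simpl. field. }
    replace ((1 - s) / (INR 1 - s)) with (scal (1 - 0) 1)
      by (unfold scal; simpl; unfold mult; simpl; field; lra).
    apply (is_RInt_const (V := R_NormedModule) 0 1 1).
  - apply (is_RInt_ext (fun v => rpow v (/ (1 - s) * INR (S n)))).
    { intros v _. rewrite rpow_pow by lia.
      rewrite Rmult_0_l, Rminus_0_r, pow1. now rewrite Rdiv_1_r. }
    pose proof (pos_INR n). rewrite !S_INR.
    replace ((1 - s) / (INR n + 1 + 1 - s))
      with (/ (/ (1 - s) * (INR n + 1) + 1)).
    + apply is_RInt_rpow. apply Rmult_lt_0_compat; lra.
    + field. lra.
Qed.

(** The factor [z] shifts the resolvent series at 0 by one index, and [(k - 1) (1 - s) = s] turns
    its coefficients into [- s / (n - s)]. *)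
Lemma hypF1_is_pseries (z : R) : Rabs z < 1 ->
  is_pseries (hyp2F1_coef (- s) 1 (1 - s)) z (hypF1 z).
Proof.
  intros hz.
  assert (h := is_pseries_resolvent _ rpow_inv_continuous rpow_inv_unit 0 z
    Rlt_0_1).
  rewrite !Rminus_0_r in h. specialize (h hz).
  apply (is_pseries_incr_1 (K := R_AbsRing) (V := R_NormedModule)) in h.
  apply (is_pseries_scal (K := R_AbsRing) (V := R_NormedModule)
    (- (/ (1 - s) - 1))) in h; [|apply Rmult_comm].
  assert (h' := is_pseries_plus _ _ _ _ _ (is_pseries_const 1 z) h).
  refine (eq_ind _ (is_pseries _ z) (is_pseries_ext _ _ _ _ _ h') _ _).
  - intros n. unfold PS_plus, PS_scal, PS_incr_1.
    rewrite hyp2F1_coef_eq, pochhammer_1.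
    pose proof (INR_fact_neq_0 n). pose proof (INR_sub_neq_0 n).
    destruct n as [|n].
    + unfold plus, scal, zero; simpl; unfold mult; simpl. field. lra.
    + rewrite resolvent_coef_rpow_0.
      set (d := INR (S n)) in *. set (e := INR (fact (S n))) in *.
      unfold plus, scal; simpl; unfold mult; simpl. field. lra.
  - unfold hypF1, plus, scal; simpl; unfold mult; simpl. ring.
Qed.

Lemma is_pseries_geom (z : R) : Rabs z < 1 -> is_pseries (fun _ => 1) z (/ (1 - z)).
Proof.
  intros hz. generalize (is_series_geom z hz). apply is_series_ext.
  intros n. change (pow_n z n) with (@pow_n R_Ring z n). rewrite (pow_n_pow z n).
  unfold scal; simpl; unfold mult; simpl. ring.
Qed.

(** The hockey-stick identity; it computes the Cauchy product with the geometric series. *)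
Lemma sum_pochhammer (b : R) (n : nat) :
  sum_f_R0 (fun i => pochhammer b i / INR (fact i)) n
  = pochhammer (b + 1) n / INR (fact n).
Proof.
  induction n as [|n IH].
  - simpl. reflexivity.
  - rewrite tech5, IH. pose proof (INR_fact_neq_0 n). pose proof (pos_INR n).
    replace (pochhammer b (S n)) with (b * pochhammer (b + 1) n)
      by (rewrite pochhammer_succ; reflexivity).
    cbn [pochhammer]. rewrite fact_simpl, mult_INR, S_INR. field. lra.
Qed.

Lemma is_pseries_inv_pow (m : nat) (z : R) : Rabs z < 1 ->
  is_pseries (fun n => pochhammer (INR (S m)) n / INR (fact n)) z (/ (1 - z) ^ S m).
Proof.
  revert z. induction m as [|m IH]; intros z hz.
  - apply (is_pseries_ext (fun _ => 1)).
    + intros n. replace (INR 1) with 1 by reflexivity. rewrite pochhammer_1.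
      symmetry. apply Rdiv_diag, INR_fact_neq_0.
    + rewrite pow_1. now apply is_pseries_geom.
  - replace (/ (1 - z) ^ S (S m)) with (/ (1 - z) ^ S m * / (1 - z))
      by (rewrite <- Rinv_mult; f_equal; simpl; ring).
    apply (is_pseries_ext (PS_mult
      (fun n => pochhammer (INR (S m)) n / INR (fact n)) (fun _ => 1))).
    + intros n. unfold PS_mult. rewrite (S_INR (S m)), <- sum_pochhammer.
      apply sum_eq. intros i _. ring.
    + apply is_pseries_mult.
      * now apply IH.
      * now apply is_pseries_geom.
      * now apply (CV_radius_ge_of_is_pseries _ _ 1 z IH).
      * now apply (CV_radius_ge_of_is_pseries _ _ 1 z is_pseries_geom).
Qed.

(** With [M = m + 1], the recursion on coefficients is the identity [- s / (n - s) * (1 + s / M) - s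
    / M = - s / (n - s) * (M + n) / M], whose last factor carries [pochhammer M n] to
    [pochhammer (M + 1) n]. *)
Lemma hypF_is_pseries (m : nat) (z : R) : Rabs z < 1 ->
  is_pseries (hyp2F1_coef (- s) (INR (S m)) (1 - s)) z (hypF m z).
Proof.
  intros hz. induction m as [|m IH]; [exact (hypF1_is_pseries z hz) |].
  apply (is_pseries_scal (K := R_AbsRing) (V := R_NormedModule)
    (1 + s / INR (S m))) in IH; [|apply Rmult_comm].
  assert (hi := is_pseries_scal (K := R_AbsRing) (V := R_NormedModule)
    (- (s / INR (S m))) _ _ _ (Rmult_comm _ _) (is_pseries_inv_pow m z hz)).
  assert (h := is_pseries_plus _ _ _ _ _ IH hi).
  refine (eq_ind _ (is_pseries _ z) (is_pseries_ext _ _ _ _ _ h) _ _).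
  - intros n. unfold PS_plus, PS_scal.
    rewrite !hyp2F1_coef_eq.
    pose proof (INR_fact_neq_0 n). pose proof (INR_sub_neq_0 n).
    assert (hm : INR (S m) <> 0) by (apply not_0_INR; lia).
    replace (pochhammer (INR (S (S m))) n)
      with (pochhammer (INR (S m)) n * (INR (S m) + INR n) / INR (S m))
      by (rewrite (S_INR (S m)), <- pochhammer_succ; field; exact hm).
    set (M := INR (S m)) in *.
    unfold plus, scal; simpl; unfold mult; cbn -[INR fact]. field. auto.
  - cbn [hypF]. unfold plus, scal; simpl; unfold mult; cbn -[INR]. ring.
Qed.

Lemma hypF_analytic (m : nat) (x : R) : x < 1 -> analytic_at (hypF m) x.
Proof.
  intros hx.
  assert (hinv : forall n, analytic_at (fun z => / (1 - z) ^ n) x).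
  { induction n as [|n IH].
    - apply (analytic_at_ext (fun _ => 1)); [|apply analytic_at_const].
      intros z. simpl. now rewrite Rinv_1.
    (* The resolvent integral with [p = 1] is [1 / (1 - z)], so the same expansion handles these
       powers. *)
    - apply (analytic_at_ext (fun z => resolvent_int (fun _ => 1) z * / (1 - z) ^ n)).
      + intros z. unfold resolvent_int. rewrite RInt_const.
        unfold scal; simpl; unfold mult; simpl.
        rewrite Rinv_mult, Rmult_1_r. ring.
      + apply analytic_at_mult; [|exact IH].
        apply analytic_at_resolvent; [|intros; lra|exact hx].
        intros v _. apply continuous_const. }
  induction m as [|m IH].
  - apply (analytic_at_ext (fun z => 1 + - (/ (1 - s) - 1) *
      (z * resolvent_int (fun v => rpow v (/ (1 - s))) z))).
    { intros z. simpl. unfold hypF1. ring. }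
    apply analytic_at_plus; [apply analytic_at_const |].
    apply analytic_at_mult; [apply analytic_at_const |].
    apply analytic_at_mult; [apply analytic_at_id |].
    apply analytic_at_resolvent;
      [exact rpow_inv_continuous | exact rpow_inv_unit | exact hx].
  - apply (analytic_at_ext (fun z => (1 + s / INR (S m)) * hypF m z
      + - (s / INR (S m)) * / (1 - z) ^ S m)).
    { intros z. cbn [hypF]. ring. }
    apply analytic_at_plus; apply analytic_at_mult; auto using analytic_at_const.
Qed.

Lemma hyp2F1_eq_hypF (m : nat) (z : R) : z < 1 ->
  hyp2F1 (- s) (INR (S m)) (1 - s) z = hypF m z.
Proof.
  intros hz. apply hyp2F1_eq; [|exact hz]. split.
  - apply hypF_is_pseries.
  - apply hypF_analytic.
Qed.

(** Gives [C1 > 0]. In the recursion the bound survives because [(1 + c) h - c r >= 1] whenever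
    [h >= 1], [r <= 1] and [c >= 0]. *)
Lemma hypF_ge_1 (m : nat) (x : R) : 0 <= x -> 1 <= hypF m (- x).
Proof.
  intros hx. induction m as [|m IH].
  - simpl. unfold hypF1.
    assert (0 <= resolvent_int (fun v => rpow v (/ (1 - s))) (- x)).
    { apply RInt_ge_0; [lra | |].
      - eexists. apply (is_RInt_resolvent _ rpow_inv_continuous rpow_inv_unit). lra.
      - intros v _. left. apply Rinv_0_lt_compat.
        pose proof (rpow_ge_0 v (/ (1 - s))). nra. }
    pose proof inv_one_sub_gt_1.
    assert (0 <= (/ (1 - s) - 1) * x) by (apply Rmult_le_pos; lra). nra.
  - cbn [hypF].
    assert (0 < s / INR (S m)) by (apply Rdiv_lt_0_compat; [lra | apply lt_0_INR; lia]).
    assert (/ (1 - - x) ^ S m <= 1).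
    { rewrite <- Rinv_1. apply Rinv_le_contravar; [lra |]. apply pow_R1_Rle. lra. }
    nra.
Qed.

End Continuation.

(** * The Gamma product and the growth of 2F1 *)

Lemma exp_le (x y : R) : x <= y -> exp x <= exp y.
Proof.
  intros [h | ->]; [left; now apply exp_increasing | apply Rle_refl].
Qed.

(** * Integrals with a variable upper end *)

Section ContinuousIntegrand.

Variable f : R -> R.
Hypothesis f_cont : forall x, continuous f x.

Lemma ex_RInt_cont (a b : R) : ex_RInt f a b.
Proof. apply (ex_RInt_continuous (V := R_CompleteNormedModule)). auto. Qed.

Lemma is_derive_RInt_cont (x : R) : is_derive (fun b => RInt f 0 b) x (f x).
Proof.
  apply (is_derive_RInt f (fun b => RInt f 0 b) 0 x); [|apply f_cont].
  apply filter_forall. intros y.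
  apply (RInt_correct (V := R_CompleteNormedModule)), ex_RInt_cont.
Qed.

Hypothesis f_pos : forall x, 0 <= f x.

Lemma RInt_cont_mono (a b : R) : a <= b -> RInt f 0 a <= RInt f 0 b.
Proof.
  intros hab.
  rewrite <- (RInt_Chasles f 0 a b) by apply ex_RInt_cont.
  assert (0 <= RInt f a b) by (apply RInt_ge_0; auto using ex_RInt_cont).
  unfold plus; simpl. lra.
Qed.

(** The limit is obtained as a supremum, because the comparisons below use the bound by [l] as well
    as the convergence to it. *)
Lemma is_lim_RInt_of_bounded (B : R) :
  (forall x, 0 <= x -> RInt f 0 x <= B) ->
  exists l : R, is_lim (fun x => RInt f 0 x) p_infty l /\
    (forall x, RInt f 0 x <= l) /\ l <= B.
Proof.
  intros hB.
  assert (hB' : forall x, RInt f 0 x <= B).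
  { intros x. apply Rle_trans with (RInt f 0 (Rmax 0 x)).
    - apply RInt_cont_mono, Rmax_r.
    - apply hB, Rmax_l. }
  destruct (completeness (fun y => exists x, y = RInt f 0 x)) as (l & hub & hlub).
  { exists B. intros y (x & ->). apply hB'. }
  { exists (RInt f 0 0). now exists 0. }
  exists l. split; [|split].
  - apply is_lim_spec. intros e.
    destruct (Classical_Prop.classic (exists x, l - e < RInt f 0 x)) as [(x & hx)|hn].
    + exists x. intros y hy.
      assert (RInt f 0 y <= l) by (apply hub; now exists y).
      pose proof (RInt_cont_mono x y (Rlt_le _ _ hy)).
      apply Rabs_def1; pose proof (cond_pos e); lra.
    + exfalso. assert (l <= l - e); [|pose proof (cond_pos e); lra].
      apply hlub. intros y (x & ->). apply Rnot_lt_le. intros h. apply hn. now exists x.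
  - intros x. apply hub. now exists x.
  - apply hlub. intros y (x & ->). apply hB'.
Qed.

End ContinuousIntegrand.

(** The sign is required on the open interval only, since the closed form of the derivative of
    [truncated] is available only for positive arguments. *)
Lemma deriv_nonneg_le (F dF : R -> R) (a b : R) : a <= b ->
  (forall y, is_derive F y (dF y)) ->
  (forall y, a < y < b -> 0 <= dF y) -> F a <= F b.
Proof.
  intros hab hF hle.
  destruct (Req_dec a b) as [->|hne]; [lra |].
  destruct (MVT_cor2 F dF a b) as (c & he & hc); [lra | |].
  - intros y _. apply is_derive_Reals, hF.
  - specialize (hle c hc). nra.
Qed.

(** Confines the doubly improper integral to one place: for each of the arguments 1, [1 - s] and
    [1 + s] a primitive and its two end limits are then enough. *)
Lemma Gamma_of_primitive (x : R) (F : R -> R) (l0 l1 : R) :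
  (forall t, 0 < t -> is_derive F t (Rpower t (x - 1) * exp (- t))) ->
  filterlim F (at_right 0) (locally l0) -> is_lim F p_infty l1 ->
  Gamma x = l1 - l0.
Proof.
  intros hF h0 h1. unfold Gamma.
  apply (is_RInt_gen_unique (V := R_CompleteNormedModule)).
  assert (hpos : filter_prod (at_right 0) (Rbar_locally p_infty)
    (fun ab : R * R => forall t,
      Rmin (fst ab) (snd ab) <= t <= Rmax (fst ab) (snd ab) -> 0 < t)).
  { apply (Filter_prod _ _ _ (fun a => 0 < a) (fun b => 0 < b)).
    - exists (mkposreal 1 Rlt_0_1). intros y _ hy. exact hy.
    - now exists 0.
    - intros a b ha hb t ht. simpl in ht.
      apply Rlt_le_trans with (Rmin a b); [now apply Rmin_glb_lt | apply ht]. }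
  apply (is_RInt_gen_ext (Derive F)).
  { revert hpos. apply filter_imp. intros ab h t ht.
    apply is_derive_unique, hF, h. lra. }
  apply is_RInt_gen_Derive; [| |exact h0|exact h1].
  - revert hpos. apply filter_imp. intros ab h t ht.
    eexists. apply hF, h, ht.
  - revert hpos. apply filter_imp. intros ab h t ht.
    specialize (h t ht).
    apply (continuous_ext_loc _ (fun u => Rpower u (x - 1) * exp (- u))).
    + apply (filter_imp (fun y => 0 < y)); [|now apply locally_pos].
      intros y hy. symmetry. now apply is_derive_unique, hF.
    + apply (continuous_mult (fun t => Rpower t (x - 1)) (fun t => exp (- t))).
      * now apply continuous_Rpower.
      * apply (ex_derive_continuous (fun t => exp (- t))). auto_derive. exact I.
Qed.

Lemma filterlim_at_right_of_continuous (F : R -> R) (x : R) :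
  continuous F x -> filterlim F (at_right x) (locally (F x)).
Proof.
  intros h. apply (filterlim_filter_le_1 F (filter_le_within _) h).
Qed.

Lemma Gamma_1 : Gamma 1 = 1.
Proof.
  rewrite (Gamma_of_primitive 1 (fun t => - exp (- t)) (-1) 0); [ring | | |].
  - intros t ht. replace (1 - 1) with 0 by ring. rewrite Rpower_O by exact ht.
    auto_derive; [exact I | ring].
  - replace (-1) with (- exp (- 0)) by (rewrite Ropp_0, exp_0; reflexivity).
    apply (filterlim_at_right_of_continuous (fun t => - exp (- t))).
    apply (ex_derive_continuous (fun t => - exp (- t))). auto_derive. exact I.
  - replace (Finite 0) with (Rbar_opp 0) by (simpl; f_equal; ring).
    apply is_lim_opp.
    apply (is_lim_comp exp Ropp p_infty 0 m_infty).
    + apply is_lim_exp_m.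
    + apply (is_lim_opp (fun y => y) p_infty p_infty), is_lim_id.
    + exists 0. intros y _. discriminate.
Qed.

Lemma is_lim_Rpower_p_infty (k : R) : 0 < k ->
  is_lim (fun x => Rpower x k) p_infty p_infty.
Proof.
  intros hk. apply is_lim_spec. intros M. exists (Rpower (Rmax 1 M) (/ k)). intros x hx.
  assert (h1 : 1 <= Rmax 1 M) by apply Rmax_l.
  apply Rle_lt_trans with (Rmax 1 M); [apply Rmax_r |].
  replace (Rmax 1 M) with (Rpower (Rpower (Rmax 1 M) (/ k)) k)
    by (rewrite Rpower_mult, Rinv_l by lra; apply Rpower_1; lra).
  apply Rlt_Rpower_l; [exact hk |]. split; [apply exp_pos | exact hx].
Qed.

Section GammaProduct.

Variable s : R.
Hypothesis s_range : 0 < s < 1.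

Let k := / (1 - s).

Let k_gt_1 : 1 < k := inv_one_sub_gt_1 s s_range.

(** At infinity this integral and the next two tend to [(1 - s) * Gamma (1 - s)], to
    [Gamma (1 + s)], and to the product of these two values. *)
Definition stretched_exp_int (x : R) : R := RInt (fun w => exp (- rpow w (/ (1 - s)))) 0 x.
Definition lower_gamma_int (x : R) : R := RInt (fun y => rpow y s * exp (- y)) 0 x.
Definition beta_int (x : R) : R := RInt (fun v => / (1 + rpow v (/ (1 - s))) ^ 2) 0 x.

Lemma stretched_exp_cont (x : R) : continuous (fun w => exp (- rpow w k)) x.
Proof.
  apply (continuous_comp (fun w => rpow w k) (fun t => exp (- t))).
  - apply continuous_rpow. lra.
  - apply (ex_derive_continuous (fun t => exp (- t))). auto_derive. exact I.
Qed.

Lemma lower_gamma_cont (x : R) : continuous (fun y => rpow y s * exp (- y)) x.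
Proof.
  apply (continuous_mult (fun y => rpow y s) (fun y => exp (- y))).
  - apply continuous_rpow. lra.
  - apply (ex_derive_continuous (fun t => exp (- t))). auto_derive. exact I.
Qed.

Lemma beta_cont (x : R) : continuous (fun v => / (1 + rpow v k) ^ 2) x.
Proof.
  apply (continuous_comp (fun w => rpow w k) (fun t => / (1 + t) ^ 2)).
  - apply continuous_rpow. lra.
  - apply (ex_derive_continuous (fun t => / (1 + t) ^ 2)). auto_derive.
    pose proof (rpow_ge_0 x k). nra.
Qed.

Lemma lower_gamma_pos (y : R) : 0 <= rpow y s * exp (- y).
Proof. apply Rmult_le_pos; [apply rpow_ge_0 | left; apply exp_pos]. Qed.

Lemma beta_pos (v : R) : 0 < / (1 + rpow v k) ^ 2.
Proof. apply Rinv_0_lt_compat, pow_lt. pose proof (rpow_ge_0 v k). lra. Qed.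

Lemma rpow_ge_id (x : R) : 1 <= x -> x <= rpow x k.
Proof.
  intros hx. rewrite rpow_pos_eq by lra.
  rewrite <- (Rpower_1 x) at 1 by lra. apply Rle_Rpower; lra.
Qed.

Lemma rpow_le_one_add (x : R) : 0 <= x -> rpow x s <= 1 + x.
Proof.
  intros hx. destruct (Rle_dec x 1) as [h1|h1].
  - pose proof (rpow_unit x s ltac:(lra) h1). lra.
  - rewrite rpow_pos_eq by lra.
    assert (Rpower x s <= Rpower x 1) by (apply Rle_Rpower; lra).
    rewrite Rpower_1 in H by lra. lra.
Qed.

Lemma lower_gamma_int_0 : lower_gamma_int 0 = 0.
Proof. unfold lower_gamma_int. rewrite RInt_point. reflexivity. Qed.

Lemma stretched_exp_int_0 : stretched_exp_int 0 = 0.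
Proof. unfold stretched_exp_int. rewrite RInt_point. reflexivity. Qed.

(** The majorant is [exp (1 - y)]: it is at least 1 up to [y = 1], and afterwards [y^k >= y]. Its
    total integral is [exp 1]. *)
Lemma stretched_exp_int_bounded (x : R) : 0 <= x -> stretched_exp_int x <= exp 1.
Proof.
  intros hx.
  assert (h : - exp (1 - 0) - stretched_exp_int 0 <= - exp (1 - x) - stretched_exp_int x).
  { apply (deriv_nonneg_le (fun x => - exp (1 - x) - stretched_exp_int x)
      (fun y => exp (1 - y) - exp (- rpow y k))); [exact hx | |].
    - intros y. apply (is_derive_minus (fun x => - exp (1 - x))).
      + auto_derive; [exact I | unfold Rminus; ring].
      + apply (is_derive_RInt_cont (fun w => exp (- rpow w k))), stretched_exp_cont.
    - intros y hy. destruct (Rle_dec y 1) as [h1|h1].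
      + assert (exp (- rpow y k) <= exp 0) by (apply exp_le; pose proof (rpow_ge_0 y k); lra).
        assert (exp 0 <= exp (1 - y)) by (apply exp_le; lra). lra.
      + assert (exp (- rpow y k) <= exp (1 - y)); [|lra].
        apply exp_le. pose proof (rpow_ge_id y ltac:(lra)). lra. }
  rewrite stretched_exp_int_0, !Rminus_0_r in h. pose proof (exp_pos (1 - x)). lra.
Qed.

(** The majorant [(1 + y) exp (- y)] has primitive [- (2 + y) exp (- y)], whence the bound 2. *)
Lemma lower_gamma_int_bounded (x : R) : 0 <= x -> lower_gamma_int x <= 2.
Proof.
  intros hx.
  assert (h : - (2 + 0) * exp (- 0) - lower_gamma_int 0
    <= - (2 + x) * exp (- x) - lower_gamma_int x).
  { apply (deriv_nonneg_le (fun x => - (2 + x) * exp (- x) - lower_gamma_int x)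
      (fun y => (1 + y) * exp (- y) - rpow y s * exp (- y)));
      [exact hx | |].
    - intros y. apply (is_derive_minus (fun x => - (2 + x) * exp (- x))).
      + auto_derive; [exact I | ring].
      + apply (is_derive_RInt_cont (fun y => rpow y s * exp (- y))), lower_gamma_cont.
    - intros y hy. pose proof (rpow_le_one_add y ltac:(lra)).
      pose proof (exp_pos (- y)). nra. }
  rewrite lower_gamma_int_0, Ropp_0, exp_0 in h. pose proof (exp_pos (- x)). nra.
Qed.

Lemma lower_gamma_int_le (a : R) : 0 <= a <= 1 -> lower_gamma_int a <= a.
Proof.
  intros ha. replace a with ((a - 0) * 1) at 2 by ring.
  apply Rle_trans with (Rabs (lower_gamma_int a)); [apply Rle_abs |].
  apply abs_RInt_le_const; [lra | |].
  - apply ex_RInt_cont, lower_gamma_cont.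
  - intros t ht. rewrite Rabs_pos_eq by apply lower_gamma_pos.
    pose proof (rpow_unit t s ltac:(lra) ltac:(lra)).
    assert (exp (- t) <= exp 0) by (apply exp_le; lra). rewrite exp_0 in *.
    pose proof (exp_pos (- t)). nra.
Qed.

(* Both iterated integrals of [y * exp (- y * (1 + v^k))] over [0, Y] x [0, N]:
   [kernel Y (1 + v^k)] is the inner one in [y], and the [Y]-derivative of
   [truncated N Y] is the inner one in [v], evaluated by rescaling. *)
Definition kernel (Y c : R) : R := / c ^ 2 - exp (- (Y * c)) * (Y / c + / c ^ 2).

Definition truncated (N Y : R) : R := RInt (fun v => kernel Y (1 + rpow v k)) 0 N.

Lemma kernel_derive (Y c : R) : 0 < c ->
  is_derive (fun Y => kernel Y c) Y (Y * exp (- (Y * c))).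
Proof.
  intros hc. unfold kernel. auto_derive; [nra |]. field. lra.
Qed.

Lemma kernel_cont (Y v : R) : continuous (fun v => kernel Y (1 + rpow v k)) v.
Proof.
  apply (continuous_comp (fun w => rpow w k) (fun t => kernel Y (1 + t))).
  - apply continuous_rpow. lra.
  - apply (ex_derive_continuous (fun t => kernel Y (1 + t))). unfold kernel. auto_derive.
    pose proof (rpow_ge_0 v k). repeat split; nra.
Qed.

Lemma truncated_derive_raw (N Y : R) :
  is_derive (truncated N) Y (RInt (fun v => Y * exp (- (Y * (1 + rpow v k)))) 0 N).
Proof.
  assert (hD : forall u v, Derive (fun Y => kernel Y (1 + rpow v k)) u
    = u * exp (- (u * (1 + rpow v k)))).
  { intros u v. apply is_derive_unique, kernel_derive. pose proof (rpow_ge_0 v k). lra. }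
  rewrite <- (RInt_ext (fun v => Derive (fun Y => kernel Y (1 + rpow v k)) Y))
    by (intros; apply hD).
  apply (is_derive_RInt_param (fun Y v => kernel Y (1 + rpow v k))).
  - apply filter_forall. intros y t _. eexists. apply kernel_derive.
    pose proof (rpow_ge_0 t k). lra.
  - intros t _.
    apply (continuity_2d_pt_ext (fun u v => u * exp (- (u * (1 + rpow v k))))).
    { intros u v. symmetry. apply hD. }
    apply continuity_2d_pt_mult; [apply continuity_2d_pt_id1 |].
    apply (continuity_1d_2d_pt_comp exp).
    { apply derivable_continuous_pt, derivable_pt_exp. }
    apply continuity_2d_pt_opp, continuity_2d_pt_mult; [apply continuity_2d_pt_id1 |].
    apply continuity_2d_pt_plus; [apply continuity_2d_pt_const |].
    apply (continuity_1d_2d_pt_comp (fun v => rpow v k) (fun _ v => v)).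
    + apply continuity_pt_filterlim. apply (continuous_rpow t k). lra.
    + apply continuity_2d_pt_id2.
  - apply filter_forall. intros y.
    apply ex_RInt_cont. apply kernel_cont.
Qed.

Lemma rpow_scale (Y v : R) : 0 < Y -> rpow (Rpower Y (1 - s) * v) k = Y * rpow v k.
Proof.
  intros hY. rewrite rpow_mult_l by apply exp_pos.
  rewrite Rpower_mult. unfold k. rewrite Rinv_r, Rpower_1; lra.
Qed.

(** Substitute [w = W v] with [W = Y^(1-s)], so that [Y v^k = w^k]; since [Y = Y^s W], the Jacobian
    leaves the factor [Y^s]. *)
Lemma truncated_derive (N Y : R) : 0 < Y ->
  RInt (fun v => Y * exp (- (Y * (1 + rpow v k)))) 0 N
  = rpow Y s * exp (- Y) * stretched_exp_int (Rpower Y (1 - s) * N).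
Proof.
  intros hY. set (W := Rpower Y (1 - s)).
  assert (hW : 0 < W) by apply exp_pos.
  assert (hYW : Y = rpow Y s * W).
  { rewrite rpow_pos_eq by exact hY. unfold W. rewrite <- Rpower_plus.
    replace (s + (1 - s)) with 1 by ring. now rewrite Rpower_1. }
  assert (h := RInt_comp_lin (fun w => exp (- rpow w k)) W 0 0 N).
  rewrite Rmult_0_r, !Rplus_0_r in h.
  unfold stretched_exp_int. fold k. fold W in h. rewrite <- h
    by (apply ex_RInt_cont, stretched_exp_cont).
  symmetry.
  refine (eq_trans (eq_sym (RInt_scal (V := R_CompleteNormedModule)
    (fun y => scal W (exp (- rpow (W * y + 0) k))) 0 N (rpow Y s * exp (- Y)) _)) _); cycle 1.
  - apply RInt_ext. intros v _. rewrite Rplus_0_r. unfold W. rewrite rpow_scale by exact hY.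
    fold W. unfold scal; simpl; unfold mult; simpl.
    replace (- (Y * (1 + rpow v k))) with (- Y + - (Y * rpow v k)) by ring.
    rewrite exp_plus.
    transitivity (rpow Y s * W * (exp (- Y) * exp (- (Y * rpow v k)))); [ring |].
    now rewrite <- hYW.
  - apply (ex_RInt_comp_lin (fun w => exp (- rpow w k)) W 0 0 N).
    apply ex_RInt_cont, stretched_exp_cont.
Qed.

Lemma lower_gamma_int_derive (Y : R) :
  is_derive lower_gamma_int Y (rpow Y s * exp (- Y)).
Proof. apply (is_derive_RInt_cont (fun y => rpow y s * exp (- y))), lower_gamma_cont. Qed.

(** The cut-off [a] is needed because, for fixed [N], the inner integral up to [y^(1-s) N] is near
    its limit only when [y] stays away from 0. *)
Lemma truncated_lower (N a Y c : R) : 0 <= a <= Y ->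
  (forall y, a < y -> c <= stretched_exp_int (Rpower y (1 - s) * N)) ->
  c * (lower_gamma_int Y - lower_gamma_int a) <= truncated N Y - truncated N a.
Proof.
  intros haY hc.
  enough (truncated N a - c * lower_gamma_int a
    <= truncated N Y - c * lower_gamma_int Y) by lra.
  eapply (deriv_nonneg_le (fun y => truncated N y - c * lower_gamma_int y)); [lra | |].
  - intros y. apply (is_derive_minus (truncated N) (fun y => c * lower_gamma_int y)).
    + apply truncated_derive_raw.
    + apply (is_derive_scal lower_gamma_int), lower_gamma_int_derive.
  - intros y hy. simpl. rewrite truncated_derive by lra.
    unfold minus, plus, opp; simpl.
    specialize (hc y ltac:(lra)). pose proof (lower_gamma_pos y). nra.
Qed.

Lemma truncated_upper (N Y c : R) : 0 <= Y ->
  (forall x, stretched_exp_int x <= c) ->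
  truncated N Y - truncated N 0 <= c * (lower_gamma_int Y - lower_gamma_int 0).
Proof.
  intros haY hc.
  enough (c * lower_gamma_int 0 - truncated N 0
    <= c * lower_gamma_int Y - truncated N Y) by lra.
  eapply (deriv_nonneg_le (fun y => c * lower_gamma_int y - truncated N y)); [lra | |].
  - intros y. apply (is_derive_minus (fun y => c * lower_gamma_int y) (truncated N)).
    + apply (is_derive_scal lower_gamma_int), lower_gamma_int_derive.
    + apply truncated_derive_raw.
  - intros y hy. simpl. rewrite truncated_derive by lra.
    unfold minus, plus, opp; simpl.
    specialize (hc (Rpower y (1 - s) * N)). pose proof (lower_gamma_pos y). nra.
Qed.

Lemma truncated_0 (N : R) : truncated N 0 = 0.
Proof.
  assert (h : forall c, 0 < c -> kernel 0 c = 0).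
  { intros c hc. unfold kernel. rewrite Rmult_0_l, Ropp_0, exp_0. field. lra. }
  unfold truncated. rewrite (RInt_ext _ (fun _ => 0)).
  - rewrite RInt_const. unfold scal; simpl; unfold mult; simpl. ring.
  - intros v _. apply h. pose proof (rpow_ge_0 v k). lra.
Qed.

Lemma truncated_le_beta (N Y : R) : 0 <= N -> 0 <= Y -> truncated N Y <= beta_int N.
Proof.
  intros hN hY. apply RInt_le; [exact hN | | |].
  - apply ex_RInt_cont, kernel_cont.
  - apply ex_RInt_cont, beta_cont.
  - intros v _. unfold kernel. fold k.
    assert (hc : 0 < 1 + rpow v k) by (pose proof (rpow_ge_0 v k); lra).
    assert (0 <= Y / (1 + rpow v k)) by (apply Rdiv_le_0_compat; lra).
    pose proof (beta_pos v). pose proof (exp_pos (- (Y * (1 + rpow v k)))).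
    nra.
Qed.

(** From [exp Y >= (1 + Y/2)^2] and [(Y + 1)^2 <= (Y + 2)^2 = 4 (1 + Y/2)^2]. *)
Lemma one_add_mul_exp_le (Y : R) : 0 <= Y -> exp (- Y) * (Y + 1) <= 4 / (Y + 1).
Proof.
  intros hY. rewrite exp_Ropp.
  assert (he : (1 + Y / 2) ^ 2 <= exp Y).
  { replace Y with (Y / 2 + Y / 2) at 2 by field. rewrite exp_plus.
    pose proof (exp_ineq1_le (Y / 2)). nra. }
  apply (Rmult_le_reg_r (exp Y * (Y + 1))); [pose proof (exp_pos Y); nra |].
  pose proof (exp_pos Y). field_simplify; [|lra|lra]. nra.
Qed.

(** As [c = 1 + v^k >= 1], the part of the kernel lost beyond [Y] is at most [exp (- Y) (Y + 1)],
    uniformly in [v]. *)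
Lemma beta_le_truncated (N Y : R) : 0 <= N -> 0 <= Y ->
  beta_int N <= truncated N Y + N * (4 / (Y + 1)).
Proof.
  intros hN hY.
  enough (beta_int N - truncated N Y <= (N - 0) * (4 / (Y + 1))) by lra.
  eapply Rle_trans; [apply Rle_abs |].
  apply (abs_is_RInt_le_const
    (fun v => minus (/ (1 + rpow v k) ^ 2) (kernel Y (1 + rpow v k))) 0 N); [exact hN | |].
  - apply (is_RInt_minus (V := R_NormedModule));
      apply (RInt_correct (V := R_CompleteNormedModule)), ex_RInt_cont.
    + apply beta_cont.
    + apply kernel_cont.
  - intros v hv. unfold minus, plus, opp, kernel; simpl.
    pose proof (rpow_ge_0 v k) as hq.
    set (c := 1 + rpow v k). assert (hc : 1 <= c) by (unfold c; lra).
    match goal with |- Rabs ?e <= _ =>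
      replace e with (exp (- (Y * c)) * (Y / c + / c ^ 2)) by (simpl; ring) end.
    assert (h1 : 0 <= Y / c <= Y).
    { split; [apply Rdiv_le_0_compat; lra |]. apply Rle_div_l; nra. }
    assert (h2 : 0 < / c ^ 2 <= 1).
    { split; [apply Rinv_0_lt_compat; nra |]. rewrite <- Rinv_1.
      apply Rinv_le_contravar; nra. }
    assert (h3 : exp (- (Y * c)) <= exp (- Y)) by (apply exp_le; nra).
    pose proof (exp_pos (- (Y * c))).
    rewrite Rabs_pos_eq by (apply Rmult_le_pos; lra).
    apply Rle_trans with (exp (- Y) * (Y + 1)); [|now apply one_add_mul_exp_le].
    apply Rmult_le_compat; lra.
Qed.

Lemma stretched_exp_int_lim :
  exists l : R, is_lim stretched_exp_int p_infty l /\ forall x, stretched_exp_int x <= l.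
Proof.
  destruct (is_lim_RInt_of_bounded (fun w => exp (- rpow w k)) stretched_exp_cont
    (fun w => Rlt_le _ _ (exp_pos _)) (exp 1)) as (l & h1 & h2 & _).
  - exact stretched_exp_int_bounded.
  - now exists l.
Qed.

Lemma lower_gamma_int_lim :
  exists l : R, is_lim lower_gamma_int p_infty l /\ forall x, lower_gamma_int x <= l.
Proof.
  destruct (is_lim_RInt_of_bounded (fun y => rpow y s * exp (- y)) lower_gamma_cont
    lower_gamma_pos 2) as (l & h1 & h2 & _).
  - exact lower_gamma_int_bounded.
  - now exists l.
Qed.

Lemma stretched_exp_int_mono (x y : R) : x <= y ->
  stretched_exp_int x <= stretched_exp_int y.
Proof.
  apply (RInt_cont_mono _ stretched_exp_cont). intros z; left; apply exp_pos.
Qed.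

Lemma truncated_nonneg (N Y : R) : 0 <= N -> 0 <= Y -> 0 <= truncated N Y.
Proof.
  intros hN hY.
  assert (h := truncated_lower N 0 Y 0 (conj (Rle_refl 0) hY)).
  rewrite truncated_0 in h.
  enough (0 <= truncated N Y - 0) by lra.
  eapply Rle_trans; [|apply h]; [lra |].
  intros y hy. rewrite <- stretched_exp_int_0. apply stretched_exp_int_mono.
  apply Rmult_le_pos; [apply Rpower_ge_0 | exact hN].
Qed.

Lemma is_lim_mul_const_p_infty (c : R) : 0 < c -> is_lim (fun x => c * x) p_infty p_infty.
Proof.
  intros hc. apply is_lim_spec. intros M. exists (M / c). intros x hx.
  apply Rlt_div_l in hx; lra.
Qed.

(** Upper bound: fix [N] and take [Y] large. Lower bound: on the rectangle with [y] between [a] and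
    [Y], first let [N] and then [Y] go to infinity, and finally take [a] small. *)
Lemma beta_int_lim (e g : R) :
  is_lim stretched_exp_int p_infty e -> (forall x, stretched_exp_int x <= e) ->
  is_lim lower_gamma_int p_infty g -> (forall x, lower_gamma_int x <= g) ->
  is_lim beta_int p_infty (e * g)%R /\ forall x, beta_int x <= e * g.
Proof.
  intros he hem hg hgm.
  assert (he0 : 0 <= e) by (rewrite <- stretched_exp_int_0; apply hem).
  assert (hg0 : 0 <= g) by (rewrite <- lower_gamma_int_0; apply hgm).
  assert (hub : forall N, 0 <= N -> beta_int N <= e * g).
  { intros N hN. apply le_epsilon. intros d hd.
    (* With this choice the truncation error is [d Y / (Y + 1)], hence at most [d]. *)
    set (Y := 4 * N / d).
    assert (hY : 0 <= Y) by (apply Rdiv_le_0_compat; lra).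
    eapply Rle_trans; [apply (beta_le_truncated N Y hN hY) |].
    apply Rplus_le_compat.
    - assert (h := truncated_upper N Y e hY hem).
      rewrite truncated_0, lower_gamma_int_0 in h.
      specialize (hgm Y). nra.
    - apply (Rmult_le_reg_r (Y + 1)); [lra |].
      replace (N * (4 / (Y + 1)) * (Y + 1)) with (d * Y)
        by (unfold Y; field; unfold Y in hY; lra).
      nra. }
  destruct (is_lim_RInt_of_bounded (fun v => / (1 + rpow v k) ^ 2) beta_cont
    (fun v => Rlt_le _ _ (beta_pos v)) (e * g) hub) as (l & hl & hlm & hle).
  enough (hel : e * g <= l).
  { replace (e * g) with l by lra. split; [exact hl | exact hlm]. }
  assert (h1 : forall a Y N, 0 < a <= Y -> 0 <= N ->
    stretched_exp_int (Rpower a (1 - s) * N) *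
      (lower_gamma_int Y - lower_gamma_int a) <= l).
  { intros a Y N haY hN.
    apply Rle_trans with (truncated N Y - truncated N a).
    - apply truncated_lower; [lra |]. intros y hy.
      apply stretched_exp_int_mono, Rmult_le_compat_r; [exact hN |].
      apply Rle_Rpower_l; lra.
    - pose proof (truncated_nonneg N a hN ltac:(lra)).
      pose proof (truncated_le_beta N Y hN ltac:(lra)).
      specialize (hlm N). change (beta_int N <= l) in hlm. lra. }
  assert (h2 : forall a Y, 0 < a <= Y ->
    e * (lower_gamma_int Y - lower_gamma_int a) <= l).
  { intros a Y haY.
    apply (is_lim_le_loc (fun N => stretched_exp_int (Rpower a (1 - s) * N)
      * (lower_gamma_int Y - lower_gamma_int a)) (fun _ => l) p_infty
      (e * (lower_gamma_int Y - lower_gamma_int a))%R l).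
    - exists 0. intros N hN. apply h1; lra.
    - apply (is_lim_scal_r _ _ _ (Finite e)).
      apply (is_lim_comp stretched_exp_int _ p_infty e p_infty he).
      + apply is_lim_mul_const_p_infty, exp_pos.
      + exists 0. intros y _. discriminate.
    - apply is_lim_const. }
  assert (h3 : forall a, 0 < a -> e * (g - lower_gamma_int a) <= l).
  { intros a ha.
    apply (is_lim_le_loc (fun Y => e * (lower_gamma_int Y - lower_gamma_int a))
      (fun _ => l) p_infty (e * (g - lower_gamma_int a))%R l).
    - exists a. intros Y hY. apply h2; lra.
    - apply (is_lim_scal_l _ _ _ (Finite (g - lower_gamma_int a))).
      apply is_lim_minus'; [exact hg | apply is_lim_const].
    - apply is_lim_const. }
  apply le_epsilon. intros d hd.
  (* The loss [e * lower_gamma_int a] is at most [e a], hence at most [d]; dividing by [e + 1]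
     avoids assuming [e] nonzero. *)
  set (a := Rmin 1 (d / (e + 1))).
  assert (ha : 0 < a) by (apply Rmin_glb_lt; [lra | apply Rdiv_lt_0_compat; lra]).
  assert (ha1 : a <= 1) by apply Rmin_l.
  assert (had : a * (e + 1) <= d) by (apply Rle_div_r; [lra | apply Rmin_r]).
  specialize (h3 a ha). pose proof (lower_gamma_int_le a ltac:(lra)). nra.
Qed.

Lemma Gamma_one_sub (e : R) : is_lim stretched_exp_int p_infty e ->
  Gamma (1 - s) = k * e.
Proof.
  intros he.
  rewrite (Gamma_of_primitive (1 - s)
    (fun x => k * stretched_exp_int (rpow x (1 - s))) 0 (k * e)).
  - ring.
  - intros t ht.
    replace (Rpower t (1 - s - 1) * exp (- t))
      with (k * (((1 - s) * Rpower t (1 - s - 1)) * exp (- rpow (rpow t (1 - s)) k))).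
    + apply (is_derive_scal (fun x => stretched_exp_int (rpow x (1 - s)))).
      apply (is_derive_comp stretched_exp_int (fun x => rpow x (1 - s))).
      * apply (is_derive_RInt_cont (fun w => exp (- rpow w k))), stretched_exp_cont.
      * now apply is_derive_rpow.
    + rewrite (rpow_pos_eq t) by exact ht.
      replace (Rpower t (1 - s)) with (Rpower t (1 - s) * 1) by ring.
      rewrite rpow_scale, rpow_pos_eq, Rpower_1_l, Rmult_1_r by lra.
      unfold k. field. lra.
  (* The primitive is written with [rpow], which vanishes at 0, so its right limit there is a matter
     of continuity. *)
  - replace (locally 0) with (locally (k * stretched_exp_int (rpow 0 (1 - s))))
      by (rewrite rpow_nonpos, stretched_exp_int_0 by lra; f_equal; ring).
    apply (filterlim_at_right_of_continuous (fun x => k * stretched_exp_int (rpow x (1 - s)))).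
    apply (continuous_comp (fun x => rpow x (1 - s)) (fun y => k * stretched_exp_int y)).
    + apply continuous_rpow. lra.
    + apply (ex_derive_continuous (fun y => k * stretched_exp_int y)). eexists.
      apply (is_derive_scal stretched_exp_int).
      apply (is_derive_RInt_cont (fun w => exp (- rpow w k))), stretched_exp_cont.
  - apply (is_lim_scal_l _ _ _ (Finite e)).
    apply (is_lim_comp stretched_exp_int _ p_infty e p_infty he).
    + apply (is_lim_ext_loc (fun x => Rpower x (1 - s))).
      * exists 0. intros x hx. now rewrite rpow_pos_eq.
      * apply is_lim_Rpower_p_infty. lra.
    + exists 0. intros y _. discriminate.
Qed.

Lemma Gamma_one_add (g : R) : is_lim lower_gamma_int p_infty g ->
  Gamma (1 + s) = g.
Proof.
  intros hg. rewrite (Gamma_of_primitive (1 + s) lower_gamma_int 0 g); [ring | | | exact hg].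
  - intros t ht. replace (1 + s - 1) with s by ring.
    rewrite <- rpow_pos_eq by exact ht. apply lower_gamma_int_derive.
  - rewrite <- lower_gamma_int_0 at 2.
    apply filterlim_at_right_of_continuous, (ex_derive_continuous lower_gamma_int).
    eexists. apply lower_gamma_int_derive.
Qed.

Lemma beta_int_lim_Gamma :
  exists l : R, is_lim beta_int p_infty l /\ (forall x, beta_int x <= l) /\
    k * l = Gamma (1 - s) * Gamma (1 + s).
Proof.
  destruct stretched_exp_int_lim as (e & he & hem).
  destruct lower_gamma_int_lim as (g & hg & hgm).
  destruct (beta_int_lim e g he hem hg hgm) as (h1 & h2).
  exists (e * g). split; [exact h1 | split; [exact h2 |]].
  rewrite (Gamma_one_sub e he), (Gamma_one_add g hg). ring.
Qed.

Lemma beta_int_pos (x : R) : 0 < x -> 0 < beta_int x.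
Proof.
  intros hx. apply RInt_gt_0; [exact hx | |].
  - intros y _. apply beta_pos.
  - intros y _. apply beta_cont.
Qed.

(** The rescaling [w = x^(1-s) v] moves the dependence on [x] into the upper end, which tends to
    infinity with [x]. *)
Lemma hypF1_neg (x : R) : 0 < x ->
  hypF s 0 (- x) = / (1 + x) + Rpower x s * (k * beta_int (Rpower x (1 - s))).
Proof.
  intros hx. simpl. unfold hypF1. fold k.
  set (W := Rpower x (1 - s)).
  assert (hW : 0 < W) by apply exp_pos.
  assert (hc : forall w, continuous (fun w => / (1 + rpow w k)) w).
  { intros w. apply (continuous_comp (fun w => rpow w k) (fun t => / (1 + t))).
    - apply continuous_rpow. lra.
    - apply (ex_derive_continuous (fun t => / (1 + t))). auto_derive.
      pose proof (rpow_ge_0 w k). lra. }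
  assert (hscale : W * resolvent_int (fun v => rpow v k) (- x)
    = RInt (fun w => / (1 + rpow w k)) 0 W).
  { assert (h := RInt_comp_lin (fun w => / (1 + rpow w k)) W 0 0 1 (ex_RInt_cont _ hc _ _)).
    rewrite Rmult_0_r, !Rplus_0_r, Rmult_1_r in h. rewrite <- h.
    unfold resolvent_int.
    assert (hi : ex_RInt (fun v => / (1 - - x * rpow v k)) 0 1).
    { eexists. apply (is_RInt_resolvent _ (rpow_inv_continuous s s_range)
        (rpow_inv_unit s s_range)). lra. }
    assert (h' := RInt_scal (V := R_CompleteNormedModule) _ 0 1 W hi).
    change (W * RInt (fun v => / (1 - - x * rpow v k)) 0 1)
      with (scal W (RInt (fun v => / (1 - - x * rpow v k)) 0 1)).
    rewrite <- h'. apply RInt_ext. intros v _.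
    rewrite Rplus_0_r. unfold W. rewrite rpow_scale by exact hx.
    do 2 f_equal. ring. }
  (* Writing [c = 1 + w^k], the derivative of [w / c] is [1 / c - k (c - 1) / c^2 = k / c^2 - (k -
     1) / c]; at the upper end [W^k = x]. *)
  assert (hparts : k * beta_int W - (k - 1) * RInt (fun w => / (1 + rpow w k)) 0 W
    = W / (1 + x)).
  { assert (hd : is_RInt
      (fun w => minus (k * / (1 + rpow w k) ^ 2) ((k - 1) * / (1 + rpow w k)))
      0 W (minus (W / (1 + rpow W k)) (0 / (1 + rpow 0 k)))).
    { apply (is_RInt_derive (fun w => w / (1 + rpow w k))).
      - rewrite Rmin_left, Rmax_right by lra. intros w hw.
        assert (hq := rpow_ge_0 w k).
        evar_last.
        + apply (is_derive_div (fun w => w) (fun w => 1 + rpow w k)).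
          * apply (is_derive_id (K := R_AbsRing)).
          * apply (is_derive_plus (fun _ => 1) (fun w => rpow w k)).
            -- apply (is_derive_const (V := R_NormedModule) 1).
            -- now apply is_derive_rpow_gt_1.
          * lra.
        + assert (hwq : w * rpow w (k - 1) = rpow w k).
          { destruct (Req_dec w 0) as [->|hw0]; [rewrite !rpow_nonpos by lra; ring |].
            rewrite !rpow_pos_eq by lra. rewrite <- (Rpower_1 w) at 1 by lra.
            rewrite <- Rpower_plus. f_equal. ring. }
          unfold minus, plus, opp, zero, one; simpl.
          replace (w * (0 + k * rpow w (k - 1))) with (k * rpow w k)
            by (rewrite <- hwq; ring).
          field. lra.
      - intros w _. apply (continuous_minus (V := R_NormedModule)
          (fun w => k * / (1 + rpow w k) ^ 2) (fun w => (k - 1) * / (1 + rpow w k))).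
        + apply (continuous_scal_r (V := R_NormedModule) k), beta_cont.
        + apply (continuous_scal_r (V := R_NormedModule) (k - 1)), hc. }
    assert (hb : is_RInt
      (fun w => minus (k * / (1 + rpow w k) ^ 2) ((k - 1) * / (1 + rpow w k)))
      0 W (minus (k * beta_int W) ((k - 1) * RInt (fun w => / (1 + rpow w k)) 0 W))).
    { apply (is_RInt_minus (V := R_NormedModule)).
      - apply (is_RInt_scal (V := R_NormedModule) (fun w => / (1 + rpow w k) ^ 2) 0 W k).
        apply (RInt_correct (V := R_CompleteNormedModule)), ex_RInt_cont, beta_cont.
      - apply (is_RInt_scal (V := R_NormedModule) (fun w => / (1 + rpow w k)) 0 W (k - 1)).
        apply (RInt_correct (V := R_CompleteNormedModule)), ex_RInt_cont, hc. }
    assert (he := is_RInt_unique _ _ _ _ hd). rewrite (is_RInt_unique _ _ _ _ hb) in he.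
    unfold minus, plus, opp in he; simpl in he.
    replace (rpow W k) with x in he.
    - unfold Rdiv in *. rewrite Rmult_0_l in he. lra.
    - unfold W. rewrite <- (Rmult_1_r (Rpower x (1 - s))), rpow_scale, rpow_pos_eq, Rpower_1_l
        by lra. ring. }
  rewrite <- hscale in hparts.
  assert (hxs : x = Rpower x s * W).
  { unfold W. rewrite <- Rpower_plus. replace (s + (1 - s)) with 1 by ring.
    now rewrite Rpower_1. }
  set (J := resolvent_int (fun v => rpow v k) (- x)) in *.
  set (P := Rpower x s) in *.
  (* Multiplied by [x^s], the boundary term becomes [x / (1 + x)], which together with [1 / (1 + x)]
     makes up the leading 1 of [hypF1]. *)
  replace (k * beta_int W) with (W / (1 + x) + (k - 1) * (W * J)) by lra.
  replace (P * (W / (1 + x) + (k - 1) * (W * J)))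
    with (P * W / (1 + x) + (k - 1) * (P * W) * J) by (field; lra).
  rewrite <- hxs. field. lra.
Qed.

End GammaProduct.

(** * The optimization problem *)

Lemma sum_n_m_1_S (a : nat -> R) (n : nat) :
  sum_n_m a 1 (S n) = sum_n_m a 1 n + a (S n).
Proof. rewrite sum_n_Sm by lia. reflexivity. Qed.

Lemma sum_n_m_1_0 (a : nat -> R) : sum_n_m a 1 0 = 0.
Proof. apply (sum_n_m_zero a). lia. Qed.

Lemma sum_n_m_le_loc (a b : nat -> R) (n : nat) :
  (forall f, (1 <= f <= n)%nat -> a f <= b f) -> sum_n_m a 1 n <= sum_n_m b 1 n.
Proof.
  induction n as [|n IH]; intros h.
  - rewrite !sum_n_m_1_0. lra.
  - rewrite !sum_n_m_1_S. apply Rplus_le_compat.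
    + apply IH. intros f hf. apply h. lia.
    + apply h. lia.
Qed.

Lemma sum_n_m_nonneg (a : nat -> R) (n : nat) :
  (forall f, (1 <= f <= n)%nat -> 0 <= a f) -> 0 <= sum_n_m a 1 n.
Proof.
  intros h. induction n as [|n IH].
  - rewrite sum_n_m_1_0. lra.
  - rewrite sum_n_m_1_S. specialize (h (S n) ltac:(lia)) as h1.
    assert (0 <= sum_n_m a 1 n) by (apply IH; intros; apply h; lia). lra.
Qed.

Lemma term_le_sum_n_m (a : nat -> R) (n f : nat) :
  (forall i, (1 <= i <= n)%nat -> 0 <= a i) -> (1 <= f <= n)%nat ->
  a f <= sum_n_m a 1 n.
Proof.
  intros h hf. induction n as [|n IH]; [lia |].
  rewrite sum_n_m_1_S.
  pose proof (h (S n) ltac:(lia)).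
  assert (h' : forall i, (1 <= i <= n)%nat -> 0 <= a i) by (intros; apply h; lia).
  destruct (Nat.eq_dec f (S n)) as [->|hne].
  - pose proof (sum_n_m_nonneg a n h'). lra.
  - specialize (IH h' ltac:(lia)). lra.
Qed.

Definition top_files (Nc f : nat) : R := if Nat.leb f Nc then 1 else 0.

Lemma sum_top_files (Nc n : nat) : sum_n_m (top_files Nc) 1 n = INR (Nat.min n Nc).
Proof.
  induction n as [|n IH]; [apply sum_n_m_1_0 |].
  rewrite sum_n_m_1_S, IH. unfold top_files.
  destruct (Nat.leb_spec (S n) Nc).
  - rewrite !Nat.min_l, S_INR by lia. reflexivity.
  - rewrite !Nat.min_r by lia. apply Rplus_0_r.
Qed.

Lemma top_files_feasible (Nf Nc : nat) : (Nc <= Nf)%nat -> feasible Nf Nc (top_files Nc).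
Proof.
  intros h. split.
  - rewrite sum_top_files, Nat.min_r by lia. lra.
  - intros f _. unfold top_files. destruct (Nat.leb f Nc); lra.
Qed.

(** The error is exactly [p q (B q) / (A + B q)]; as [e <= 1/2], the denominator is at least
    [A / 2], which gives the factor 2. *)
Lemma ratio_linear_approx (A B p q e : R) : 0 < A -> 0 <= e <= 1 / 2 ->
  Rabs B <= e * A -> 0 <= p -> 0 <= q <= 1 ->
  Rabs (A * (p * q / (A + B * q)) - p * q) <= 2 * e * p.
Proof.
  intros hA he hB hp hq.
  assert (hBq : Rabs (B * q) <= e * A).
  { rewrite Rabs_mult, (Rabs_pos_eq q) by lra. pose proof (Rabs_pos B). nra. }
  assert (hD : A / 2 <= A + B * q) by (apply Rabs_le_between in hBq; nra).
  replace (A * (p * q / (A + B * q)) - p * q)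
    with (- (p * q * (B * q) / (A + B * q))) by (field; lra).
  rewrite Rabs_Ropp. unfold Rdiv. rewrite !Rabs_mult, Rabs_inv.
  rewrite <- (Rabs_mult B q), (Rabs_pos_eq (A + B * q)), (Rabs_pos_eq p),
    (Rabs_pos_eq q) by lra.
  apply Rle_div_l; [lra |].
  apply Rle_trans with (p * (e * A)).
  - rewrite Rmult_assoc. apply Rmult_le_compat_l; [exact hp |].
    pose proof (Rabs_pos (B * q)). nra.
  - assert (0 <= e * p) by (apply Rmult_le_pos; lra). nra.
Qed.

(** Here [mu] acts as a Lagrange multiplier for the capacity: [p f - mu] is at least [eta] on the
    cached files and at most [- eta] on the others, so every deviation costs at least [eta] per
    unit. *)
Lemma maximizer_near_top_files (A B e eta mu : R) (p q : nat -> R) (Nf Nc : nat) :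
  0 < A -> 0 <= e <= 1 / 2 -> Rabs B <= e * A -> 0 <= mu -> (Nc <= Nf)%nat ->
  (forall f, (1 <= f <= Nf)%nat -> 0 <= p f) ->
  (forall f, (1 <= f <= Nc)%nat -> mu + eta <= p f) ->
  (forall f, (Nc < f <= Nf)%nat -> p f <= mu - eta) ->
  feasible Nf Nc q ->
  sum_n_m (fun f => p f * top_files Nc f / (A + B * top_files Nc f)) 1 Nf <=
    sum_n_m (fun f => p f * q f / (A + B * q f)) 1 Nf ->
  forall f, (1 <= f <= Nf)%nat -> 0 <= eta ->
  eta * Rabs (q f - top_files Nc f) <= 4 * e * sum_n_m p 1 Nf.
Proof.
  intros hA he hB hmu hN hp htop hbot (hsum & hq) hopt f hf heta.
  set (q0 := top_files Nc) in *.
  apply Rle_trans with (sum_n_m (fun f => eta * Rabs (q f - q0 f)) 1 Nf).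
  { apply (term_le_sum_n_m (fun f => eta * Rabs (q f - q0 f))); [|exact hf].
    intros i _. apply Rmult_le_pos; [exact heta | apply Rabs_pos]. }
  set (t := fun f => p f * q0 f / (A + B * q0 f)) in *.
  set (u := fun f => p f * q f / (A + B * q f)) in *.
  (* Linearizing both objectives costs [2 e p] each, hence [4 e p]; what remains is
     [A (t - u) + mu (q - q0)]. *)
  apply Rle_trans with
    (sum_n_m (fun f => A * t f + (- A * u f +
      (4 * e * p f + (- mu * q0 f + mu * q f)))) 1 Nf).
  - apply sum_n_m_le_loc. intros i hi.
    assert (hq0 : 0 <= q0 i <= 1) by (unfold q0, top_files; destruct (Nat.leb i Nc); lra).
    assert (h1 := ratio_linear_approx A B (p i) (q0 i) e hA he hB (hp i hi) hq0).
    assert (h2 := ratio_linear_approx A B (p i) (q i) e hA he hB (hp i hi) (hq i hi)).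
    fold (t i) in h1. fold (u i) in h2.
    apply Rabs_le_between in h1. apply Rabs_le_between in h2.
    assert (h3 : eta * Rabs (q i - q0 i) <= (p i - mu) * (q0 i - q i)).
    { specialize (hq i hi). unfold q0, top_files.
      destruct (Nat.leb_spec i Nc) as [hic|hic].
      - specialize (htop i ltac:(lia)). rewrite Rabs_left1 by lra. nra.
      - specialize (hbot i ltac:(lia)). rewrite Rabs_pos_eq by lra. nra. }
    lra.
  - assert (hplus : forall a b : nat -> R,
      sum_n_m (fun i => a i + b i) 1 Nf = sum_n_m a 1 Nf + sum_n_m b 1 Nf)
      by (intros a b; exact (sum_n_m_plus a b 1 Nf)).
    assert (hscal : forall c (a : nat -> R),
      sum_n_m (fun i => c * a i) 1 Nf = c * sum_n_m a 1 Nf)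
      by (intros c a; exact (sum_n_m_mult_l c a 1 Nf)).
    rewrite !hplus, !hscal.
    (* The top files fill the capacity exactly, so the [mu] part is nonpositive; the [A] part is
       nonpositive by optimality. *)
    unfold q0 at 1. rewrite sum_top_files, Nat.min_r by lia. nra.
Qed.

(** * Zipf weights and estimates for large [gamma0] *)

Lemma zipf_pos (delta : R) (Nf f : nat) : (1 <= Nf)%nat -> 0 < zipf delta Nf f.
Proof.
  intros hN. apply Rdiv_lt_0_compat; [apply exp_pos |].
  apply Rlt_le_trans with (Rpower (INR 1) (- delta)); [apply exp_pos |].
  apply (term_le_sum_n_m (fun n => Rpower (INR n) (- delta))); [|lia].
  intros; left; apply exp_pos.
Qed.

Lemma zipf_decr (delta : R) (Nf f g : nat) : 0 < delta -> (1 <= Nf)%nat ->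
  (1 <= f < g)%nat -> zipf delta Nf g < zipf delta Nf f.
Proof.
  intros hd hN hfg. unfold zipf. apply Rmult_lt_compat_r.
  - apply Rinv_0_lt_compat.
    apply Rlt_le_trans with (Rpower (INR 1) (- delta)); [apply exp_pos |].
    apply (term_le_sum_n_m (fun n => Rpower (INR n) (- delta))); [|lia].
    intros; left; apply exp_pos.
  - rewrite !Rpower_Ropp. apply Rinv_lt_contravar.
    + apply Rmult_lt_0_compat; apply exp_pos.
    + apply Rlt_Rpower_l; [exact hd |]. split; [apply lt_0_INR | apply lt_INR]; lia.
Qed.

Lemma C1_pos (lambda12 P12 B12 alpha gamma0 : R) (M1 : nat) :
  0 < lambda12 -> 0 < B12 -> 2 < alpha -> (1 <= M1)%nat -> 0 < gamma0 ->
  0 < Defs.C1 lambda12 P12 B12 alpha M1 1 gamma0.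
Proof.
  intros hl hB ha hM hg. unfold Defs.C1.
  assert (hs : 0 < 2 / alpha < 1).
  { split; [apply Rdiv_lt_0_compat; lra | apply Rlt_div_l; lra]. }
  assert (hx : 0 < gamma0 / (INR M1 / INR 1 * B12)).
  { apply Rdiv_lt_0_compat; [exact hg |]. apply Rmult_lt_0_compat; [|exact hB].
    apply Rdiv_lt_0_compat; apply lt_0_INR; lia. }
  apply Rmult_lt_0_compat; [apply Rmult_lt_0_compat; [exact hl | apply exp_pos] |].
  destruct M1 as [|m]; [lia |].
  rewrite hyp2F1_eq_hypF by lra.
  apply Rlt_le_trans with 1; [lra |]. apply hypF_ge_1; lra.
Qed.

(* By Euler's Beta integral, [C2] is the leading term of the hypergeometric
   function in [C3]. *)
Lemma C3_negligible (alpha e : R) : 2 < alpha -> 0 < e ->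
  exists M, forall gamma0, M < gamma0 ->
    0 < C2 alpha 1 gamma0 /\
    Rabs (C3 alpha 1 gamma0 + 1) <= e * C2 alpha 1 gamma0.
Proof.
  intros ha he. set (s := 2 / alpha).
  assert (hs : 0 < s < 1).
  { split; [apply Rdiv_lt_0_compat; lra | apply Rlt_div_l; lra]. }
  destruct (beta_int_lim_Gamma s hs) as (l & hlim & hle & hG).
  pose proof (inv_one_sub_gt_1 s hs) as hk. set (k := / (1 - s)) in *.
  assert (hl : 0 < l).
  { apply Rlt_le_trans with (beta_int s 1); [apply beta_int_pos; lra | apply hle]. }
  assert (hkl : 0 < k * l) by (apply Rmult_lt_0_compat; lra).
  assert (hC2 : forall g, C2 alpha 1 g = k * l * Rpower g s).
  { intros g. unfold C2. fold s. change (INR 1) with 1.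
    rewrite Gamma_1, Rdiv_1_r, hG. reflexivity. }
  assert (hlimW : is_lim (fun g => beta_int s (Rpower g (1 - s))) p_infty l).
  { apply (is_lim_comp (beta_int s) _ p_infty l p_infty hlim).
    - apply is_lim_Rpower_p_infty. lra.
    - exists 0. intros y _. discriminate. }
  apply is_lim_spec in hlimW.
  assert (he' : 0 < e * l / 2) by (apply Rdiv_lt_0_compat; nra).
  destruct (hlimW (mkposreal _ he')) as (M & hM). simpl in hM.
  (* Half of [e * C2] is allotted to each error: [M] handles the tail [l - I], and the last bound
     handles [1 / (1 + g)], using [P >= 1]. *)
  exists (Rmax (Rmax 1 M) (2 / (e * (k * l)))). intros g hg.
  assert (hg1 : 1 < g) by (eapply Rle_lt_trans; [|exact hg]; eapply Rle_trans; apply Rmax_l).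
  assert (hgM : M < g)
    by (eapply Rle_lt_trans; [|exact hg]; eapply Rle_trans; [apply Rmax_r | apply Rmax_l]).
  assert (hge : 2 / (e * (k * l)) < g) by (eapply Rle_lt_trans; [apply Rmax_r | exact hg]).
  specialize (hM g hgM). apply Rabs_def2 in hM.
  specialize (hle (Rpower g (1 - s))).
  assert (hP : 1 <= Rpower g s).
  { rewrite <- (Rpower_O g) by lra. apply Rle_Rpower; lra. }
  rewrite hC2. split; [apply Rmult_lt_0_compat; lra |].
  unfold C3. rewrite hC2. fold s.
  rewrite (hyp2F1_eq_hypF s hs 0) by lra. rewrite hypF1_neg by lra.
  fold k. set (I := beta_int s (Rpower g (1 - s))) in *. set (P := Rpower g s) in *.
  assert (hinv : 0 < / (1 + g) <= e * (k * l) / 2).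
  { split; [apply Rinv_0_lt_compat; lra |].
    assert (hekl : 0 < e * (k * l)) by (apply Rmult_lt_0_compat; lra).
    replace (e * (k * l) / 2) with (/ (2 / (e * (k * l)))) by (field; lra).
    apply Rinv_le_contravar; [apply Rdiv_lt_0_compat; lra | lra]. }
  replace (/ (1 + g) + P * (k * I) - k * l * P - 1 + 1)
    with (/ (1 + g) - P * (k * (l - I))) by ring.
  assert (h1 : 0 <= k * (l - I) <= e * (k * l) / 2) by nra.
  apply Rabs_le. nra.
Qed.

Lemma qstar_near_top_files (lambda12 P12 B12 alpha delta : R) (M1 Nf Nc : nat)
  (qstar : R -> nat -> R) :
  0 < lambda12 -> 0 < B12 -> 2 < alpha -> 0 < delta -> (1 <= M1)%nat ->
  (1 <= Nc)%nat -> (Nc <= Nf)%nat ->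
  (forall gamma0, 0 < gamma0 ->
     is_optimal_caching lambda12 P12 B12 alpha delta M1 1 Nf Nc gamma0 (qstar gamma0)) ->
  forall f, (1 <= f <= Nf)%nat ->
  is_lim (fun gamma0 => qstar gamma0 f) p_infty (top_files Nc f).
Proof.
  intros hlambda hB ha hd hM hNc hN hopt f hf.
  set (p := zipf delta Nf).
  assert (hp : forall i, 0 < p i) by (intros i; apply zipf_pos; lia).
  (* The formula [zipf] makes sense at every index, so the gap exists even when [Nc = Nf] and [S Nc]
     is not a file. *)
  assert (hdecr := zipf_decr delta Nf Nc (S Nc) hd ltac:(lia) ltac:(lia)).
  fold p in hdecr.
  set (mu := (p Nc + p (S Nc)) / 2). set (eta := (p Nc - p (S Nc)) / 2).
  assert (heta : 0 < eta) by (unfold eta; lra).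
  assert (hmu : 0 <= mu) by (unfold mu; pose proof (hp Nc); pose proof (hp (S Nc)); lra).
  set (T := sum_n_m p 1 Nf).
  assert (hT : 0 <= T) by (apply sum_n_m_nonneg; intros; left; apply hp).
  apply is_lim_spec. intros d. pose proof (cond_pos d) as hd0.
  (* The bound [4 e T] must fall strictly below [eta * d]: the 8 leaves a factor 2 to spare, and
     [T + 1] keeps the denominator positive. The cap [1 / 2] is the one required by the
     linearization. *)
  set (e := Rmin (1 / 2) (eta * d / (8 * (T + 1)))).
  assert (he : 0 < e).
  { apply Rmin_glb_lt; [lra |]. apply Rdiv_lt_0_compat; nra. }
  assert (he2 : e <= 1 / 2) by apply Rmin_l.
  assert (heT : e * (8 * (T + 1)) <= eta * d) by (apply Rle_div_r; [lra | apply Rmin_r]).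
  destruct (C3_negligible alpha e ha he) as (M & hMg).
  exists (Rmax 0 M). intros g hg.
  assert (hg0 : 0 < g) by (eapply Rle_lt_trans; [apply Rmax_l | exact hg]).
  assert (hgM : M < g) by (eapply Rle_lt_trans; [apply Rmax_r | exact hg]).
  destruct (hMg g hgM) as (hC2 & hC3).
  pose proof (C1_pos lambda12 P12 B12 alpha g M1 hlambda hB ha hM hg0) as hC1.
  destruct (hopt g hg0) as (hfeas & hmax).
  assert (h : eta * Rabs (qstar g f - top_files Nc f) <= 4 * e * T).
  { apply (maximizer_near_top_files
      (Defs.C1 lambda12 P12 B12 alpha M1 1 g + C2 alpha 1 g) (C3 alpha 1 g + 1) e eta mu p
      (qstar g) Nf Nc); auto.
    - lra.
    - lra.
    - eapply Rle_trans; [exact hC3 |]. apply Rmult_le_compat_l; lra.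
    - intros i _. left. apply hp.
    - intros i hi. replace (mu + eta) with (p Nc) by (unfold mu, eta; field).
      destruct (Nat.eq_dec i Nc) as [->|hne]; [lra |].
      left. apply zipf_decr; [exact hd | lia | lia].
    - intros i hi. replace (mu - eta) with (p (S Nc)) by (unfold mu, eta; field).
      destruct (Nat.eq_dec i (S Nc)) as [->|hne]; [lra |].
      left. apply zipf_decr; [exact hd | lia | lia].
    - exact (hmax (top_files Nc) (top_files_feasible Nf Nc hN)).
    - lra. }
  apply (Rmult_lt_reg_l eta); [exact heta |]. nra.
Qed.

Theorem corollary2
  (lambda12 P12 B12 alpha delta : R) (M1 M2 Nf Nc : nat)
  (qstar : R -> nat -> R)
  (hlambda12 : 0 < lambda12) (hP12 : 0 < P12) (hB12 : 0 < B12)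
  (halpha : 2 < alpha) (hdelta : 0 < delta)
  (hM1 : (1 <= M1)%nat) (hM2 : M2 = 1%nat)
  (hNc : (1 <= Nc)%nat) (hNcNf : (Nc <= Nf)%nat)
  (hqstar : forall gamma0 : R, 0 < gamma0 ->
     is_optimal_caching lambda12 P12 B12 alpha delta M1 M2 Nf Nc gamma0
       (qstar gamma0)) :
  (forall f : nat, (1 <= f <= Nc)%nat ->
     is_lim (fun gamma0 => qstar gamma0 f) p_infty 1) /\
  (forall f : nat, (Nc < f <= Nf)%nat ->
     is_lim (fun gamma0 => qstar gamma0 f) p_infty 0).
Proof.
  subst M2.
  assert (h := qstar_near_top_files lambda12 P12 B12 alpha delta M1 Nf Nc qstar
    hlambda12 hB12 halpha hdelta hM1 hNc hNcNf hqstar).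
  split; intros f hf; specialize (h f ltac:(lia)); unfold top_files in h;
    destruct (Nat.leb_spec f Nc); (exact h || lia).
Qed.
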